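(* There is a constant $C>0$ such that for every $n\in\mathbb{N}$ there exists a set $S_n\subset\mathbb{R}^2$ of at most $C\,n^{3/2}\log n$ points (for $n\ge 2$) that is $n$-universal for planar 3-trees; that is, every planar 3-tree with $n$ vertices has a straight-line embedding in the plane in which the vertices are mapped to distinct points of $S_n$.
   Context: A planar 3-tree is a graph obtained as follows: start with a triangle $K_3$ embedded in the plane; repeatedly pick a (triangular) face of the current plane graph, insert a new vertex in its interior and join it by edges to the three vertices of that face. (Equivalently, each new vertex is joined to the three vertices of a triangle, and no two new vertices are joined to all vertices of the same triangle.) A straight-line embedding of a planar graph maps vertices to distinct points and edges to straight line segments between the corresponding points such that no two segments cross (they may meet only at common endpoints). A point set $S\subset\mathbb{R}^2$ is $n$-universal for a family of planar graphs if every $n$-vertex graph in the family has a straight-line embedding whose vertices are mapped into $S$. *)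

(* Defs.v *)
From Stdlib Require Import Reals List Permutation Arith.
Import ListNotations.
Open Scope R_scope.

Definition point : Type := (R * R)%type.

Definition on_segment (a b x : point) : Prop :=
  exists t : R, 0 <= t <= 1 /\
    fst x = (1 - t) * fst a + t * fst b /\
    snd x = (1 - t) * snd a + t * snd b.

Definition simple_graph (n : nat) (E : nat -> nat -> Prop) : Prop :=
  (forall u v, E u v -> (u < n)%nat /\ (v < n)%nat) /\
  (forall u v, E u v -> E v u) /\
  (forall u, ~ E u u).

(* Planar 3-tree, combinatorial description: there is an insertion order
   s = [s_0; ...; s_(n-1)] of all vertices such that s_0 s_1 s_2 is a
   triangle, each later s_k is adjacent, among the earlier vertices, to
   exactly three vertices forming a triangle, and no two later vertices
   are attached to the same triangle. *)
Definition planar_3_tree (n : nat) (E : nat -> nat -> Prop) : Prop :=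
  simple_graph n E /\ (3 <= n)%nat /\
  exists s : list nat, Permutation s (seq 0 n) /\
    let v := fun k => nth k s 0%nat in
    E (v 0%nat) (v 1%nat) /\ E (v 1%nat) (v 2%nat) /\ E (v 0%nat) (v 2%nat) /\
    (forall k, (3 <= k < n)%nat ->
       exists i j l, (i < j < l)%nat /\ (l < k)%nat /\
         E (v i) (v j) /\ E (v j) (v l) /\ E (v i) (v l) /\
         forall m, (m < k)%nat -> (E (v k) (v m) <-> m = i \/ m = j \/ m = l)) /\
    (forall k k', (3 <= k)%nat -> (k < k')%nat -> (k' < n)%nat ->
       ~ (forall m, ((m < k)%nat /\ E (v k) (v m)) <->
                    ((m < k')%nat /\ E (v k') (v m)))).

Definition straight_line_embedding (n : nat) (E : nat -> nat -> Prop)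
    (p : nat -> point) : Prop :=
  (forall u v, (u < n)%nat -> (v < n)%nat -> p u = p v -> u = v) /\
  (forall a b c d, E a b -> E c d ->
     ~ ((a = c /\ b = d) \/ (a = d /\ b = c)) ->
     forall x, on_segment (p a) (p b) x -> on_segment (p c) (p d) x ->
       exists w, (w = a \/ w = b) /\ (w = c \/ w = d) /\ x = p w).

(* Main.v *)
(** Stretch the grid exponentially: put column [x] and row [y] at [(x, b ^ y)] with [b] large.
    Then a point in a row above those of [l] and [r] is to the left of the line from [l] to [r]
    whenever [l] is in a column before [r], so drawing a planar 3-tree reduces to nested boxes:
    the vertex inserted in the triangle [l r c] cuts its box into a bottom box of full width and
    two upper boxes side by side.

    With [D = 2 ^ k] and [n <= D ^ 2], we work in a grid of side [O(D ^ 2)] and use two point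
    sets of size [O(k D ^ 3)]: points whose coordinates are divisible by powers of two with
    product at least [D], and diagonals of [D x D] blocks at all dyadic scales. Boxes are allotted
    with area proportional to [D ^ 2] times the size of the subtree. A vertex whose subtree has
    size at most [D] then has a window of area at least [4 D] for its position, which contains a
    point of the first set; so has a vertex that is charged for [D] units of size, which is
    affordable when the number of its subtrees of size at least [D] is not one. The remaining
    vertices form chains, which are cut into groups of total size about [D]; the vertices of a
    group are placed on block diagonals along the sides of the current box. *)

Require Import Defs.
From Stdlib Require Import Reals List Permutation Arith ZArith Lia Lra Psatz.
From Stdlib Require Import Classical ClassicalEpsilon.
Import ListNotations.
Open Scope R_scope.

(** * Packing ternary trees into sparse grids *)

(** A leaf is a face that stays empty. A node is the vertex inserted into a face; [B], [L], [R]
    belong to the three faces it creates: below it, to its upper left and to its upper right. *)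
Inductive ttree : Type :=
| Leaf
| Node (v : nat) (B L R : ttree).

Fixpoint size (t : ttree) : nat :=
  match t with Leaf => 0 | Node _ B L R => 1 + size B + size L + size R end.

(* In the stretched grid the grid points inside the triangle [l r c] of [nested] below form the
   box bounded by the columns of [l] and [r], the higher of their rows, and the row of [c].
   A new vertex cuts it into a full-width bottom box and two upper boxes side by side. *)
Fixpoint fits (S : nat -> nat -> Prop) (x0 x1 y0 y1 : R) (t : ttree) : Prop :=
  match t with
  | Leaf => True
  | Node _ B L R => exists x y : nat,
      S x y /\ x0 < INR x < x1 /\ y0 < INR y < y1 /\
      fits S x0 x1 y0 (INR y) B /\
      fits S x0 (INR x) (INR y) y1 L /\
      fits S (INR x) x1 (INR y) y1 R
  end.

Lemma fits_mono S t : forall x0 x1 y0 y1 x0' x1' y0' y1',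
  x0' <= x0 -> x1 <= x1' -> y0' <= y0 -> y1 <= y1' ->
  fits S x0 x1 y0 y1 t -> fits S x0' x1' y0' y1' t.
Proof.
induction t as [|v B IHB L IHL R IHR]; intros x0 x1 y0 y1 x0' x1' y0' y1' H1 H2 H3 H4; [easy|].
intros (x & y & HS & Hx & Hy & FB & FL & FR); exists x, y.
split; [exact HS|]; split; [lra|]; split; [lra|].
split; [|split].
- revert FB; apply IHB; lra.
- revert FL; apply IHL; lra.
- revert FR; apply IHR; lra.
Qed.

(** * Dyadic points in boxes *)

Lemma pow2_below (s : R) : 1 < s -> exists a : nat, 2 ^ a < s <= 2 * 2 ^ a.
Proof.
intros Hs.
assert (Hex : exists m : nat, s <= 2 ^ m).
{ destruct (Pow_x_infinity 2) with (b := s) as [m Hm].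
  - rewrite Rabs_pos_eq; lra.
  - exists m. specialize (Hm m (le_n m)).
    rewrite Rabs_pos_eq in Hm; [lra|]. apply pow_le; lra. }
destruct Hex as [m Hm].
induction m as [|m IH]; simpl in Hm; [lra|].
destruct (Rle_dec s (2 ^ m)) as [H|H]; [now apply IH|].
exists m; lra.
Qed.

Lemma pow2_above (s : R) : 1 < s -> exists a : nat, s <= 2 ^ a < 2 * s.
Proof. intros Hs; destruct (pow2_below s Hs) as [a Ha]; exists (S a); simpl; lra. Qed.

Lemma nat_floor (u : R) : 0 <= u -> exists m : nat, INR m <= u < INR m + 1.
Proof.
intros Hu; destruct (archimed u) as [H1 H2].
assert (Hz : (1 <= up u)%Z).
{ apply Zlt_le_succ with (n := 0%Z). apply lt_IZR; simpl; lra. }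
exists (Z.to_nat (up u - 1)).
rewrite INR_IZR_INZ, Z2Nat.id by lia. rewrite minus_IZR; lra.
Qed.

Lemma multiple_above (d u : R) : 0 < d -> 0 <= u ->
  exists m : nat, u < d * INR m <= u + d.
Proof.
intros Hd Hu.
destruct (nat_floor (u / d)) as [m Hm].
{ apply Rmult_le_pos; [lra|]. left; apply Rinv_0_lt_compat; lra. }
exists (S m); rewrite S_INR.
assert (E : u = d * (u / d)) by (field; lra).
set (q := u / d) in *. nra.
Qed.

Lemma multiple_below (d u : R) : 0 < d -> 0 <= u ->
  exists m : nat, u - d < d * INR m <= u.
Proof.
intros Hd Hu.
destruct (nat_floor (u / d)) as [m Hm].
{ apply Rmult_le_pos; [lra|]. left; apply Rinv_0_lt_compat; lra. }
exists m.
assert (E : u = d * (u / d)) by (field; lra).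
set (q := u / d) in *. nra.
Qed.

Definition dyadic (k x y : nat) : Prop :=
  exists a b i j : nat, (k <= a + b)%nat /\ x = (2 ^ a * i)%nat /\ y = (2 ^ b * j)%nat.

(* Increasing and decreasing diagonals of the square blocks of side [2 ^ k] in the grid scaled
   by [2 ^ a] and [2 ^ b]; in the decreasing case the point is only used when the truncated
   subtraction is exact. *)
Definition diagonal (k x y : nat) : Prop :=
  exists a b i j s : nat, (a <= 12 + k)%nat /\ (b <= 12 + k)%nat /\
   (i <= 2 ^ (12 + k - a))%nat /\ (j <= 2 ^ (12 + k - b))%nat /\ (s <= 3 * 2 ^ k)%nat /\
   (x = 2 ^ a * (2 ^ k * i + s) \/ x = 2 ^ a * (2 ^ k * i - s))%nat /\
   y = (2 ^ b * (2 ^ k * j + s))%nat.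

Definition sparse (k x y : nat) : Prop := dyadic k x y \/ diagonal k x y.

Lemma INR_pow2 (a : nat) : INR (2 ^ a) = 2 ^ a.
Proof. rewrite pow_INR; reflexivity. Qed.

Lemma pow2_le_inv (a b : nat) : 2 ^ a <= 2 ^ b -> (a <= b)%nat.
Proof.
intros H; destruct (Nat.le_gt_cases a b) as [Hl|Hl]; [exact Hl|].
assert (2 ^ b < 2 ^ a) by (apply Rlt_pow; [lra|lia]). lra.
Qed.

(** Each side is longer than a power of two that is at least half of it, so it contains a multiple
    of that power. The product of the two powers is at least a quarter of the area, hence at least
    [2 ^ k]. *)
Lemma dyadic_point_in_box (k : nat) (u u' v v' : R) :
  0 <= u -> 0 <= v -> 1 < u' - u -> 1 < v' - v ->
  4 * 2 ^ k <= (u' - u) * (v' - v) ->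
  exists x y : nat, dyadic k x y /\ u < INR x < u' /\ v < INR y < v'.
Proof.
intros Hu Hv Hs Ht Hst.
destruct (pow2_below _ Hs) as [a Ha].
destruct (pow2_below _ Ht) as [b Hb].
assert (Pa : 0 < 2 ^ a) by (apply pow_lt; lra).
assert (Pb : 0 < 2 ^ b) by (apply pow_lt; lra).
destruct (multiple_above (2 ^ a) u Pa Hu) as [i Hi].
destruct (multiple_above (2 ^ b) v Pb Hv) as [j Hj].
exists (2 ^ a * i)%nat, (2 ^ b * j)%nat.
rewrite !mult_INR, !INR_pow2.
split; [|lra].
exists a, b, i, j; split; [|easy].
apply pow2_le_inv; rewrite pow_add. nra.
Qed.

(* The own weight [o] is charged twice, for a horizontal and for a vertical strip in which the
   point is free to move; all three parts keep the ratio [q] of area to weight. *)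
Lemma split_box (k : nat) (x0 x1 y0 y1 mb ml mr o q : R) :
  0 <= x0 -> 0 <= y0 -> 0 <= mb -> 0 <= ml -> 0 <= mr -> 0 < o ->
  let m := mb + ml + mr + 2 * o in
  m < (x1 - x0) * o -> m < (y1 - y0) * o ->
  4 * 2 ^ k * (m * m) <= ((x1 - x0) * o) * ((y1 - y0) * o) ->
  q * m <= (x1 - x0) * (y1 - y0) ->
  exists x y : nat, dyadic k x y /\ x0 < INR x < x1 /\ y0 < INR y < y1 /\
    q * mb <= (x1 - x0) * (INR y - y0) /\
    q * ml <= (INR x - x0) * (y1 - INR y) /\
    q * mr <= (x1 - INR x) * (y1 - INR y).
Proof.
intros Hx0 Hy0 Hb Hl Hr Ho m Hw Hh Hk Hq.
set (w := x1 - x0) in *; set (h := y1 - y0) in *.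
assert (Hm : 0 < m) by (unfold m; lra).
assert (Hwp : 0 < w) by nra.
assert (Hhp : 0 < h) by nra.
set (m' := ml + mr + o).
assert (Hm' : 0 < m') by (unfold m'; lra).
assert (Hmm : m' <= m) by (unfold m', m; lra).
(* From bottom to top the height is cut into [e * mb], the window [e * o] and [e * m']; from left to
   right the width is cut into [f * ml], the window [f * o] and [f * mr]. *)
set (e := h / m). set (f := w / m').
assert (Ee : h = e * m) by (unfold e; field; lra).
assert (Ef : w = f * m') by (unfold f; field; lra).
assert (He : 0 < e) by (unfold e; apply Rdiv_lt_0_compat; lra).
assert (Hf : 0 < f) by (unfold f; apply Rdiv_lt_0_compat; lra).
assert (Hfw : w <= f * m) by nra.
assert (He1 : 1 < e * o) by (rewrite Ee in Hh; nra).
assert (Hf1 : 1 < f * o).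
{ assert (w * o <= f * o * m) by nra. nra. }
destruct (dyadic_point_in_box k (x0 + f * ml) (x0 + f * ml + f * o)
            (y0 + e * mb) (y0 + e * mb + e * o)) as (x & y & HS & Hx & Hy).
- nra.
- nra.
- lra.
- lra.
- replace ((x0 + f * ml + f * o - (x0 + f * ml)) * (y0 + e * mb + e * o - (y0 + e * mb)))
    with (f * o * (e * o)) by ring.
  assert (A1 : (w * o) * (h * o) <= (f * m * o) * (e * m * o)).
  { rewrite Ee at 1. apply Rmult_le_compat; nra. }
  assert (A2 : 4 * 2 ^ k * (m * m) <= (f * o * (e * o)) * (m * m)) by nra.
  apply Rmult_le_reg_r with (m * m); nra.
- assert (Ex1 : x1 = x0 + f * (ml + mr + o)) by (fold m'; unfold w in Ef; lra).
  assert (Ey1 : y1 = y0 + e * (mb + m' + o))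
    by (replace (mb + m' + o) with m by (unfold m, m'; ring); unfold h in Ee; lra).
  (* All three parts have area at least [e * f * m'] times their weight, so this single bound
     preserves the ratio [q]. *)
  assert (Q : q <= e * f * m').
  { apply Rmult_le_reg_r with m; [lra|].
    replace (e * f * m' * m) with (w * h) by (rewrite Ee, Ef; ring). lra. }
  assert (T : e * m' <= y1 - INR y) by (rewrite Ey1; lra).
  assert (Fl : 0 <= f * ml) by nra. assert (Fr : 0 <= f * mr) by nra.
  assert (Eb : 0 <= e * mb) by nra. assert (Em : 0 < e * m') by nra.
  exists x, y; split; [exact HS|].
  split; [rewrite Ex1; nra|]. split; [rewrite Ey1; nra|].
  split; [|split].
  + apply Rle_trans with (w * (e * mb)).
    * rewrite Ef. replace (f * m' * (e * mb)) with (e * f * m' * mb) by ring. nra.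
    * apply Rmult_le_compat_l; lra.
  + apply Rle_trans with ((f * ml) * (e * m')).
    * replace (f * ml * (e * m')) with (e * f * m' * ml) by ring. nra.
    * apply Rmult_le_compat; lra.
  + apply Rle_trans with ((f * mr) * (e * m')).
    * replace (f * mr * (e * m')) with (e * f * m' * mr) by ring. nra.
    * apply Rmult_le_compat; lra.
Qed.

(** Doubled weights pay for the two strips of a root of own weight 1. One side being at most
    [4096 * D ^ 2], the other is at least [4 * m]; and [m <= D] turns the area bound into
    [16 * D * m ^ 2 <= w * h], which gives a window of area at least [4 * D]. *)
Lemma fits_light (k : nat) (t : ttree) : forall x0 x1 y0 y1 : R,
  INR (size t) <= 2 ^ k -> 0 <= x0 -> 0 <= y0 ->
  x0 < x1 <= 4096 * (2 ^ k * 2 ^ k) -> y0 < y1 <= 4096 * (2 ^ k * 2 ^ k) ->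
  8192 * (2 ^ k * 2 ^ k) * (2 * INR (size t)) <= (x1 - x0) * (y1 - y0) ->
  fits (sparse k) x0 x1 y0 y1 t.
Proof.
induction t as [|v B IHB L IHL R IHR]; intros x0 x1 y0 y1 Hs Hx0 Hy0 Hx Hy Ha; [exact I|].
assert (Es : INR (size (Node v B L R)) = 1 + INR (size B) + INR (size L) + INR (size R)).
{ cbn [size]. rewrite !plus_INR; simpl; ring. }
rewrite Es in *.
assert (PB := pos_INR (size B)); assert (PL := pos_INR (size L)); assert (PR := pos_INR (size R)).
set (D := 2 ^ k) in *.
set (b := INR (size B)) in *; set (l := INR (size L)) in *; set (r := INR (size R)) in *.
set (m := 1 + b + l + r) in *.
assert (Hm : 1 <= m) by (unfold m; lra).
assert (HD : 1 <= D) by lra.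
assert (HDD : 1 <= D * D) by nra.
set (w := x1 - x0) in *; set (h := y1 - y0) in *.
assert (Hw : 0 < w <= 4096 * (D * D)) by (unfold w; lra).
assert (Hh : 0 < h <= 4096 * (D * D)) by (unfold h; lra).
assert (Hw4 : 4 * m <= w).
{ apply Rmult_le_reg_l with (4096 * (D * D)); [lra|]. nra. }
assert (Hh4 : 4 * m <= h).
{ apply Rmult_le_reg_l with (4096 * (D * D)); [lra|]. nra. }
destruct (split_box k x0 x1 y0 y1 (2 * b) (2 * l) (2 * r) 1 (8192 * (D * D)))
  as (x & y & HS & Hxx & Hyy & AB & AL & AR); try lra; fold w h; fold D.
- unfold m in *; lra.
- unfold m in *; lra.
- replace (2 * b + 2 * l + 2 * r + 2 * 1) with (2 * m) by (unfold m; ring).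
  apply Rle_trans with (w * h); [|lra].
  apply Rle_trans with (2 := Ha).
  assert (D * (m * m) <= D * (D * m)) by (apply Rmult_le_compat_l; nra).
  assert (0 <= D * D * m) by nra.
  lra.
- replace (2 * b + 2 * l + 2 * r + 2 * 1) with (2 * m) by (unfold m; ring). lra.
- exists x, y; split; [left; exact HS|]; split; [exact Hxx|]; split; [exact Hyy|].
  assert (0 <= INR x) by apply pos_INR. assert (0 <= INR y) by apply pos_INR.
  split; [apply IHB|split; [apply IHL|apply IHR]]; unfold m in *; try lra.
Qed.

(** * Heavy subtrees: chains on block diagonals and the induction on the weight *)

Definition heavy (k : nat) (t : ttree) : bool := (2 ^ k <=? size t)%nat.

Definition one_heavy_child (k : nat) (t : ttree) : Prop :=
  match t with
  | Leaf => False
  | Node _ B L R =>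
      (heavy k B && negb (heavy k L) && negb (heavy k R) ||
       negb (heavy k B) && heavy k L && negb (heavy k R) ||
       negb (heavy k B) && negb (heavy k L) && heavy k R)%bool = true
  end.

Section Chain.

Variables k a b i0 i1 j0 j1 : nat.
(** With units [2 ^ a] horizontally and [2 ^ b] vertically, the sides of the box lie at multiples of
    [D] units, so its corners are corners of blocks. [W] and [H] are what remains after removing
    [3 * D] units on every side. *)
Let D := (2 ^ k)%R.
Let N := 4096 * (D * D).
Let X0 := 2 ^ a * (D * INR i0).
Let X1 := 2 ^ a * (D * INR i1).
Let Y0 := 2 ^ b * (D * INR j0).
Let Y1 := 2 ^ b * (D * INR j1).
Let W := X1 - X0 - 2 * (2 ^ a * (3 * D)).
Let H := Y1 - Y0 - 2 * (2 ^ b * (3 * D)).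

Hypothesis X1N : X1 <= N.
Hypothesis Y1N : Y1 <= N.
Hypothesis W_ge : 4 * D <= W.
(** One vertical unit times a quarter of [W] is at least [16384 * (D * D)], the area that
    [fits_light] requires per node. [H_area] is the counterpart for one horizontal unit. *)
Hypothesis W_area : 65536 * (D * D) <= 2 ^ b * W.
Hypothesis H_pos : 0 < H.
Hypothesis H_area : 65536 * (D * D) <= 2 ^ a * H.
Hypothesis a_le : (a <= 12 + k)%nat.
Hypothesis b_le : (b <= 12 + k)%nat.
Hypothesis i0_le : (i0 <= 2 ^ (12 + k - a))%nat.
Hypothesis i1_le : (i1 <= 2 ^ (12 + k - a))%nat.
Hypothesis j0_le : (j0 <= 2 ^ (12 + k - b))%nat.

Definition fits_core (s : nat) (t : ttree) : Prop :=
  fits (sparse k) (X0 + 2 ^ a * INR s) (X1 - 2 ^ a * INR s)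
              (Y0 + 2 ^ b * INR s) (Y1 - 2 ^ b * INR s) t.

Lemma fits_core_mono (s s' : nat) (t : ttree) :
  (s <= s')%nat -> fits_core s' t -> fits_core s t.
Proof.
intros Hs%le_INR.
assert (Pa : 0 < 2 ^ a) by (apply pow_lt; lra).
assert (Pb : 0 < 2 ^ b) by (apply pow_lt; lra).
apply fits_mono; nra.
Qed.

(* Nodes on the heavy path are placed on the diagonals of the corner blocks, at the offset given
   by the total size of what has been cut off so far, so that a group of nodes of total size
   about [D] costs only a strip of width about [2 ^ a * D] (height [2 ^ b * D]) on each side. *)
Lemma fits_chain (t : ttree) : forall s : nat,
  heavy k t = true -> (s < 2 ^ k)%nat ->
  (forall t' s', heavy k t' = true -> (s' + size t' = s + size t)%nat ->
     (s <= s')%nat -> (2 ^ k <= s')%nat \/ ~ one_heavy_child k t' ->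
     fits_core (3 * 2 ^ k) t') ->
  fits_core s t.
Proof.
assert (Pa : 1 <= 2 ^ a) by (apply pow_R1_Rle; lra).
assert (Pb : 1 <= 2 ^ b) by (apply pow_R1_Rle; lra).
assert (PD : 1 <= D) by (apply pow_R1_Rle; lra).
assert (PDD : 1 <= D * D) by nra.
assert (ED : INR (2 ^ k) = D) by apply INR_pow2.
assert (PX0 : 0 <= X0) by (unfold X0; repeat apply Rmult_le_pos; try lra; apply pos_INR).
assert (PY0 : 0 <= Y0) by (unfold Y0; repeat apply Rmult_le_pos; try lra; apply pos_INR).
induction t as [|v B IHB L IHL R IHR]; intros s Ht Hs Hend.
{ exact I. }
assert (Hstop : one_heavy_child k (Node v B L R) \/ ~ one_heavy_child k (Node v B L R)).
{ unfold one_heavy_child; destruct (_ || _)%bool; [left|right]; easy. }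
destruct Hstop as [Hone|Hstop].
2:{ apply fits_core_mono with (3 * 2 ^ k)%nat; [lia|]. apply (Hend _ s); [easy|lia|lia|tauto]. }
assert (Hlt : forall u, heavy k u = false -> (size u < 2 ^ k)%nat).
{ intros u Hu; apply Nat.leb_gt; exact Hu. }
(* Passing to the heavy child: a group that has reached size [2 ^ k] ends here, otherwise the chain
   continues. The offset stays within [3 * 2 ^ k], because from below [2 ^ k] it grows by one node
   and two light subtrees. *)
assert (Hlast : forall u s', heavy k u = true -> (s' + size u = s + size (Node v B L R))%nat ->
          (s < s')%nat -> (s' <= 3 * 2 ^ k)%nat ->
          (forall s0 : nat, heavy k u = true -> (s0 < 2 ^ k)%nat ->
             (forall t' s'0, heavy k t' = true -> (s'0 + size t' = s0 + size u)%nat ->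
               (s0 <= s'0)%nat ->
               (2 ^ k <= s'0)%nat \/ ~ one_heavy_child k t' ->
               fits_core (3 * 2 ^ k) t') -> fits_core s0 u) ->
          fits_core s' u).
{ intros u s' Hu Hsz Hss Hs3 IH.
  destruct (Nat.le_gt_cases (2 ^ k) s') as [Hd|Hd].
  - apply fits_core_mono with (3 * 2 ^ k)%nat; [easy|]. apply (Hend _ s'); [easy|easy|lia|tauto].
  - apply IH; [easy|easy|]. intros t' s'0 H1 H2 H3 H4. apply (Hend _ s'0); [easy|lia|lia|tauto]. }
unfold one_heavy_child in Hone.
set (g := (size (Node v B L R))%nat) in *.
assert (Eg : g = (1 + size B + size L + size R)%nat) by reflexivity.
clearbody g.
assert (Ps := pos_INR s).
assert (Hgeo : forall s', (s < s')%nat -> (s' <= 3 * 2 ^ k)%nat ->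
   INR s + 1 <= INR s' /\ INR s' <= 3 * D /\
   W <= (X1 - 2 ^ a * INR s') - (X0 + 2 ^ a * INR s') /\
   H <= (Y1 - 2 ^ b * INR s') - (Y0 + 2 ^ b * INR s') /\
   2 ^ a * INR s < 2 ^ a * INR s' /\ 2 ^ b * INR s < 2 ^ b * INR s' /\
   0 <= 2 ^ a * INR s /\ 0 <= 2 ^ b * INR s).
{ intros s' H1 H2.
  assert (K1 : INR s + 1 <= INR s') by (rewrite <- S_INR; apply le_INR; lia).
  assert (K2 : INR s' <= 3 * D).
  { rewrite <- ED. replace (3 * INR (2 ^ k)) with (INR (3 * 2 ^ k)) by (rewrite mult_INR; simpl; ring).
    now apply le_INR. }
  unfold W, H. repeat split; try lra; nra. }
assert (Hlight : forall u x0 x1 y0 y1, heavy k u = false ->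
   0 <= x0 -> 0 <= y0 -> x0 < x1 -> y0 < y1 -> x1 <= X1 -> y1 <= Y1 ->
   16384 * (D * D) * INR (size u) <= (x1 - x0) * (y1 - y0) -> fits (sparse k) x0 x1 y0 y1 u).
{ intros u x0 x1 y0 y1 Hu K1 K2 K3 K4 K5 K6 K7.
  apply fits_light; fold D; try lra.
  - rewrite <- ED. apply le_INR. specialize (Hlt u Hu). lia.
  - fold N; lra.
  - fold N; lra. }
destruct (heavy k B) eqn:EB; destruct (heavy k L) eqn:EL; destruct (heavy k R) eqn:ER;
  try discriminate Hone; clear Hone.
- (* heavy bottom child: cut along the top strip *)
  assert (LL := Hlt _ EL). assert (LR := Hlt _ ER).
  set (s' := (s + (1 + size L + size R))%nat).
  assert (Hs' : (s < s' <= 3 * 2 ^ k)%nat) by (unfold s'; lia).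
  destruct (Hgeo s' (proj1 Hs') (proj2 Hs')) as (G1 & G2 & G3 & G4 & G5 & G6 & G7 & G8).
  assert (Eds : INR s' = INR s + 1 + INR (size L) + INR (size R)).
  { unfold s'. rewrite !plus_INR; simpl; ring. }
  assert (PL := pos_INR (size L)). assert (PR := pos_INR (size R)).
  assert (Hj1 : (s' <= 2 ^ k * j1)%nat).
  { apply INR_le. rewrite mult_INR, ED.
    apply Rmult_le_reg_l with (2 ^ b); [lra|]. fold Y1. nra. }
  (* Here the vertex goes near the middle of the top strip: a column divisible by [D] makes it
     dyadic in any row, and [4 * D <= W] leaves width at least [W / 4] on either side. *)
  destruct (multiple_above D ((X0 + X1) / 2 - D / 2)) as [i Hi]; [lra|unfold W in *; nra|].
  assert (Ex : INR (2 ^ k * i) = D * INR i) by (rewrite mult_INR, ED; ring).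
  assert (Ey : INR (2 ^ b * (2 ^ k * j1 - s')) = Y1 - 2 ^ b * INR s').
  { rewrite mult_INR, minus_INR, mult_INR, ED, INR_pow2 by easy. unfold Y1; ring. }
  assert (AL : 16384 * (D * D) * INR (size L) <= W / 4 * (2 ^ b * INR s' - 2 ^ b * INR s)).
  { apply Rle_trans with (W / 4 * (2 ^ b * INR (size L))); [nra|].
    apply Rmult_le_compat_l; [lra|]. nra. }
  assert (AR : 16384 * (D * D) * INR (size R) <= W / 4 * (2 ^ b * INR s' - 2 ^ b * INR s)).
  { apply Rle_trans with (W / 4 * (2 ^ b * INR (size R))); [nra|].
    apply Rmult_le_compat_l; [lra|]. nra. }
  exists (2 ^ k * i)%nat, (2 ^ b * (2 ^ k * j1 - s'))%nat.
  rewrite Ex, Ey.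
  split; [|split; [lra|split; [lra|split; [|split]]]].
  + left; exists k, 0%nat, i, (2 ^ b * (2 ^ k * j1 - s'))%nat.
    split; [lia|]. split; [easy|]. simpl; lia.
  + assert (Hl : fits_core s' B).
    { apply Hlast; [easy|unfold s'; lia|lia|lia|intros s0 _; exact (IHB s0 eq_refl)]. }
    revert Hl; apply fits_mono; lra.
  + apply Hlight; try lra; try easy.
    apply Rle_trans with (1 := AL). apply Rmult_le_compat; lra.
  + apply Hlight; try lra; try easy.
    apply Rle_trans with (1 := AR). apply Rmult_le_compat; lra.
- (* heavy left child: cut along the bottom and right strips *)
  assert (LB := Hlt _ EB). assert (LR := Hlt _ ER).
  set (s' := (s + (1 + size B + size R))%nat).
  assert (Hs' : (s < s' <= 3 * 2 ^ k)%nat) by (unfold s'; lia).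
  destruct (Hgeo s' (proj1 Hs') (proj2 Hs')) as (G1 & G2 & G3 & G4 & G5 & G6 & G7 & G8).
  assert (Eds : INR s' = INR s + 1 + INR (size B) + INR (size R)).
  { unfold s'. rewrite !plus_INR; simpl; ring. }
  assert (PB := pos_INR (size B)). assert (PR := pos_INR (size R)).
  assert (Hi1 : (s' <= 2 ^ k * i1)%nat).
  { apply INR_le. rewrite mult_INR, ED.
    apply Rmult_le_reg_l with (2 ^ a); [lra|]. fold X1. nra. }
  assert (Ex : INR (2 ^ a * (2 ^ k * i1 - s')) = X1 - 2 ^ a * INR s').
  { rewrite mult_INR, minus_INR, mult_INR, ED, INR_pow2 by easy. unfold X1; ring. }
  assert (Ey : INR (2 ^ b * (2 ^ k * j0 + s')) = Y0 + 2 ^ b * INR s').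
  { rewrite mult_INR, plus_INR, mult_INR, ED, INR_pow2 by easy. unfold Y0; ring. }
  assert (AB : 16384 * (D * D) * INR (size B) <= W * (2 ^ b * INR s' - 2 ^ b * INR s)).
  { apply Rle_trans with (W * (2 ^ b * INR (size B))); [nra|].
    apply Rmult_le_compat_l; [lra|]. nra. }
  assert (AR : 16384 * (D * D) * INR (size R) <= (2 ^ a * INR s' - 2 ^ a * INR s) * H).
  { apply Rle_trans with ((2 ^ a * INR (size R)) * H); [nra|].
    apply Rmult_le_compat_r; [lra|]. nra. }
  (* This is the lower right corner of the core at offset [s'], on a decreasing block diagonal: [L]
     gets the core, [B] the strip below and [R] the strip to the right. *)
  exists (2 ^ a * (2 ^ k * i1 - s'))%nat, (2 ^ b * (2 ^ k * j0 + s'))%nat.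
  rewrite Ex, Ey.
  split; [|split; [lra|split; [lra|split; [|split]]]].
  + right; exists a, b, i1, j0, s'. repeat split; try easy. now right.
  + apply Hlight; try lra; try easy.
    apply Rle_trans with (1 := AB). apply Rmult_le_compat; lra.
  + assert (Hl : fits_core s' L).
    { apply Hlast; [easy|unfold s'; lia|lia|lia|intros s0 _; exact (IHL s0 eq_refl)]. }
    revert Hl; apply fits_mono; lra.
  + apply Hlight; try lra; try easy.
    apply Rle_trans with (1 := AR). apply Rmult_le_compat; lra.
- (* heavy right child: cut along the bottom and left strips *)
  assert (LB := Hlt _ EB). assert (LL := Hlt _ EL).
  set (s' := (s + (1 + size B + size L))%nat).
  assert (Hs' : (s < s' <= 3 * 2 ^ k)%nat) by (unfold s'; lia).
  destruct (Hgeo s' (proj1 Hs') (proj2 Hs')) as (G1 & G2 & G3 & G4 & G5 & G6 & G7 & G8).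
  assert (Eds : INR s' = INR s + 1 + INR (size B) + INR (size L)).
  { unfold s'. rewrite !plus_INR; simpl; ring. }
  assert (PB := pos_INR (size B)). assert (PL := pos_INR (size L)).
  assert (Ex : INR (2 ^ a * (2 ^ k * i0 + s')) = X0 + 2 ^ a * INR s').
  { rewrite mult_INR, plus_INR, mult_INR, ED, INR_pow2 by easy. unfold X0; ring. }
  assert (Ey : INR (2 ^ b * (2 ^ k * j0 + s')) = Y0 + 2 ^ b * INR s').
  { rewrite mult_INR, plus_INR, mult_INR, ED, INR_pow2 by easy. unfold Y0; ring. }
  assert (AB : 16384 * (D * D) * INR (size B) <= W * (2 ^ b * INR s' - 2 ^ b * INR s)).
  { apply Rle_trans with (W * (2 ^ b * INR (size B))); [nra|].
    apply Rmult_le_compat_l; [lra|]. nra. }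
  assert (AL : 16384 * (D * D) * INR (size L) <= (2 ^ a * INR s' - 2 ^ a * INR s) * H).
  { apply Rle_trans with ((2 ^ a * INR (size L)) * H); [nra|].
    apply Rmult_le_compat_r; [lra|]. nra. }
  exists (2 ^ a * (2 ^ k * i0 + s'))%nat, (2 ^ b * (2 ^ k * j0 + s'))%nat.
  rewrite Ex, Ey.
  split; [|split; [lra|split; [lra|split; [|split]]]].
  + right; exists a, b, i0, j0, s'. repeat split; try easy. now left.
  + apply Hlight; try lra; try easy.
    apply Rle_trans with (1 := AB). apply Rmult_le_compat; lra.
  + apply Hlight; try lra; try easy.
    apply Rle_trans with (1 := AL). apply Rmult_le_compat; lra.
  + assert (Hl : fits_core s' R).
    { apply Hlast; [easy|unfold s'; lia|lia|lia|intros s0 _; exact (IHR s0 eq_refl)]. }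
    revert Hl; apply fits_mono; lra.
Qed.

End Chain.

(* The negative term is the potential that pays for nodes with several heavy children and for
   groups of the chain that stop before reaching total size [2 ^ k]. *)
Definition weight (k : nat) (t : ttree) : R :=
  if heavy k t then 1200 * INR (size t) - 400 * 2 ^ k else 2 * INR (size t).

Lemma heavy_size (k : nat) (t : ttree) : heavy k t = true -> 2 ^ k <= INR (size t).
Proof. intros Ht; rewrite <- INR_pow2; apply le_INR, Nat.leb_le, Ht. Qed.

Lemma light_size (k : nat) (t : ttree) : heavy k t = false -> INR (size t) <= 2 ^ k.
Proof. intros Ht; rewrite <- INR_pow2; apply le_INR, Nat.lt_le_incl, Nat.leb_gt, Ht. Qed.

Lemma weight_ge0 (k : nat) (t : ttree) : 0 <= weight k t.
Proof.
unfold weight; destruct (heavy k t) eqn:E; assert (P := pos_INR (size t)); [|lra].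
assert (Hs := heavy_size k t E). assert (0 < 2 ^ k) by (apply pow_lt; lra). lra.
Qed.

(** With two or three heavy children the term [- 400 * 2 ^ k] occurs more often among the children
    than at the root. With none, the children are charged 2 per node instead of 1200, and there are
    at least [2 ^ k] nodes. *)
Lemma stop_weight (k v : nat) (B L R : ttree) :
  let t := Node v B L R in
  heavy k t = true -> ~ one_heavy_child k t ->
  weight k B + weight k L + weight k R + 2 * 2 ^ k <= weight k t - 384 * 2 ^ k.
Proof.
intros t Ht Hstop.
assert (Es : INR (size t) = 1 + INR (size B) + INR (size L) + INR (size R)).
{ unfold t; cbn [size]. rewrite !plus_INR; simpl; ring. }
assert (Hs := heavy_size k t Ht).
assert (PB := pos_INR (size B)); assert (PL := pos_INR (size L)); assert (PR := pos_INR (size R)).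
assert (HD : 0 < 2 ^ k) by (apply pow_lt; lra).
unfold weight. rewrite Ht, Es in *. unfold t in Hstop; cbn [one_heavy_child] in Hstop.
destruct (heavy k B); destruct (heavy k L); destruct (heavy k R);
  try (exfalso; now apply Hstop); lra.
Qed.

(** By [stop_weight] the root can be given own weight [D]. Its window then has area at least
    [4 * D], since the total weight [m] is at most [2048 * (D * D)]. *)
Lemma fits_stop (k v : nat) (x0 x1 y0 y1 : R) (B L R : ttree) :
  let t := Node v B L R in
  let D := 2 ^ k in
  heavy k t = true -> ~ one_heavy_child k t ->
  (forall u x0 x1 y0 y1, (size u < size t)%nat -> 0 <= x0 -> 0 <= y0 ->
    x0 < x1 <= 4096 * (D * D) -> y0 < y1 <= 4096 * (D * D) ->
    8192 * (D * D) * weight k u <= (x1 - x0) * (y1 - y0) ->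
    fits (sparse k) x0 x1 y0 y1 u) ->
  0 <= x0 -> 0 <= y0 ->
  x0 < x1 <= 4096 * (D * D) -> y0 < y1 <= 4096 * (D * D) ->
  8192 * (D * D) * (weight k t - 384 * D) <= (x1 - x0) * (y1 - y0) ->
  fits (sparse k) x0 x1 y0 y1 t.
Proof.
intros t D Ht Hstop IH Hx0 Hy0 Hx Hy Ha.
assert (Hw := stop_weight k v B L R Ht Hstop). fold t D in Hw.
assert (PB := weight_ge0 k B); assert (PL := weight_ge0 k L); assert (PR := weight_ge0 k R).
assert (PD : 1 <= D) by (apply pow_R1_Rle; lra).
assert (PDD : 1 <= D * D) by nra.
set (m := weight k B + weight k L + weight k R + 2 * D) in *.
assert (Pm : 0 < m) by (unfold m; lra).
assert (Hm : 8192 * (D * D) * m <= (x1 - x0) * (y1 - y0)) by nra.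
clear Ha Hw.
assert (Hw2 : 2 * m <= x1 - x0).
{ apply Rmult_le_reg_l with (4096 * (D * D)); [lra|]. nra. }
assert (Hh2 : 2 * m <= y1 - y0).
{ apply Rmult_le_reg_l with (4096 * (D * D)); [lra|]. nra. }
destruct (split_box k x0 x1 y0 y1 (weight k B) (weight k L) (weight k R) D (8192 * (D * D)))
  as (x & y & HS & Hxx & Hyy & AB & AL & AR); try lra; fold D; fold m; try lra.
- nra.
- nra.
- assert (M2 : m <= 2048 * (D * D)) by lra.
  assert (K : D * (m * m) <= D * (m * (2048 * (D * D)))) by (apply Rmult_le_compat_l; nra).
  assert (K2 : D * (m * (D * D)) <= (D * D) * (m * (D * D))) by (apply Rmult_le_compat_r; nra).
  replace ((x1 - x0) * D * ((y1 - y0) * D)) with ((D * D) * ((x1 - x0) * (y1 - y0))) by ring.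
  assert (K3 : (D * D) * (8192 * (D * D) * m) <= (D * D) * ((x1 - x0) * (y1 - y0)))
    by (apply Rmult_le_compat_l; lra).
  lra.
- assert (0 <= INR x) by apply pos_INR. assert (0 <= INR y) by apply pos_INR.
  exists x, y; split; [left; exact HS|]; split; [exact Hxx|]; split; [exact Hyy|].
  split; [|split]; apply IH; try lra; unfold t; cbn [size]; lia.
Qed.

Lemma pow2_cofactor (k a i : nat) : 2 ^ a * (2 ^ k * INR i) <= 4096 * (2 ^ k * 2 ^ k) ->
  (a <= 12 + k)%nat -> (i <= 2 ^ (12 + k - a))%nat.
Proof.
intros H Ha.
assert (PD : 0 < 2 ^ k) by (apply pow_lt; lra).
assert (Pa : 0 < 2 ^ a) by (apply pow_lt; lra).
apply INR_le; rewrite INR_pow2.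
apply Rmult_le_reg_l with (2 ^ a); [lra|].
rewrite <- pow_add. replace (a + (12 + k - a))%nat with (12 + k)%nat by lia.
rewrite pow_add. replace (2 ^ 12) with 4096 by ring.
apply Rmult_le_reg_l with (2 ^ k); [lra|]. lra.
Qed.

(** Choose [2 ^ a] between [98304 * D ^ 2 / h] and twice that. Then [8 * (D * 2 ^ a)], the width of
    one block lost to rounding and three to strips on each of two sides, is at most the fraction
    [192 * D / phi] of [w]. *)
Lemma strip_scale (D phi w h : R) : 1 <= D -> 800 * D <= phi ->
  0 < w <= 4096 * (D * D) -> 0 < h <= 4096 * (D * D) ->
  8192 * (D * D) * phi <= w * h ->
  exists a : nat, 98304 * (D * D) <= 2 ^ a * h /\ 8 * (D * 2 ^ a) * phi <= 192 * D * w.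
Proof.
intros HD Hphi Hw Hh Ha.
assert (HDD : 1 <= D * D) by nra.
destruct (pow2_above (98304 * (D * D) / h)) as [a Ha2].
{ apply Rmult_lt_reg_r with h; [lra|]. unfold Rdiv. rewrite Rmult_assoc, Rinv_l by lra. lra. }
set (s := 98304 * (D * D) / h) in *.
assert (Es : s * h = 98304 * (D * D)) by (unfold s; field; lra).
exists a; split; [nra|].
apply Rmult_le_reg_r with h; [lra|].
assert (K1 : 2 ^ a * h <= 2 * s * h) by (apply Rmult_le_compat_r; lra).
assert (K2 : 2 ^ a * h <= 196608 * (D * D)) by lra.
assert (K3 : (D * phi) * (2 ^ a * h) <= (D * phi) * (196608 * (D * D)))
  by (apply Rmult_le_compat_l; nra).
assert (K4 : D * (8192 * (D * D) * phi) <= D * (w * h)) by (apply Rmult_le_compat_l; lra).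
lra.
Qed.

(** Strong induction on the size. A heavy tree has its box trimmed to block boundaries and its heavy
    path placed in the frame by [fits_chain]; where the chain ends, the weight has dropped enough to
    compensate for the area of the frame. *)
Lemma fits_weight (k n : nat) : let D := 2 ^ k in
  forall (t : ttree) (x0 x1 y0 y1 : R), (size t <= n)%nat -> 0 <= x0 -> 0 <= y0 ->
  x0 < x1 <= 4096 * (D * D) -> y0 < y1 <= 4096 * (D * D) ->
  8192 * (D * D) * weight k t <= (x1 - x0) * (y1 - y0) ->
  fits (sparse k) x0 x1 y0 y1 t.
Proof.
intros D.
assert (PD : 1 <= D) by (apply pow_R1_Rle; lra).
assert (PDD : 1 <= D * D) by nra.
induction n as [n IHn] using (well_founded_induction lt_wf).
intros t x0 x1 y0 y1 Hn Hx0 Hy0 Hx Hy Ha.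
destruct (heavy k t) eqn:Et.
2:{ apply fits_light; try easy; [now apply light_size|].
    unfold weight in Ha; rewrite Et in Ha; exact Ha. }
assert (IH : forall u x0 x1 y0 y1, (size u < size t)%nat -> 0 <= x0 -> 0 <= y0 ->
    x0 < x1 <= 4096 * (D * D) -> y0 < y1 <= 4096 * (D * D) ->
    8192 * (D * D) * weight k u <= (x1 - x0) * (y1 - y0) ->
    fits (sparse k) x0 x1 y0 y1 u).
{ intros u u0 u1 z0 z1 Hu; apply (IHn (size u)); lia. }
clear IHn.
assert (Hs := heavy_size k t Et). fold D in Hs.
set (phi := weight k t) in *.
assert (Ephi : phi = 1200 * INR (size t) - 400 * D) by (unfold phi, weight; rewrite Et; easy).
assert (Pphi : 800 * D <= phi) by lra.
set (w := x1 - x0) in *; set (h := y1 - y0) in *.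
assert (Hw : 0 < w <= 4096 * (D * D)) by (unfold w; lra).
assert (Hh : 0 < h <= 4096 * (D * D)) by (unfold h; lra).
destruct (strip_scale D phi w h) as (a & A1 & A2); try easy.
destruct (strip_scale D phi h w) as (b & B1 & B2); try easy; [lra|].
assert (Pa : 1 <= 2 ^ a) by (apply pow_R1_Rle; lra).
assert (Pb : 1 <= 2 ^ b) by (apply pow_R1_Rle; lra).
(* [e] bounds the fraction of each side lost to the frame. The area keeps a factor of at least
   [1 - 2 * e], enough for weight [phi - 384 * D]; [800 * D <= phi] gives [e <= 24 / 100]. *)
set (e := 192 * D / phi).
assert (Ee : e * phi = 192 * D) by (unfold e; field; lra).
assert (He : 0 < e) by (unfold e; apply Rdiv_lt_0_compat; lra).
assert (He24 : e <= 24 / 100).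
{ apply Rmult_le_reg_r with phi; [lra|]. lra. }
assert (Sa : 8 * (D * 2 ^ a) <= e * w).
{ apply Rmult_le_reg_r with phi; [lra|].
  replace (e * w * phi) with (e * phi * w) by ring. rewrite Ee; lra. }
assert (Sb : 8 * (D * 2 ^ b) <= e * h).
{ apply Rmult_le_reg_r with phi; [lra|].
  replace (e * h * phi) with (e * phi * h) by ring. rewrite Ee; lra. }
assert (Da : 1 <= D * 2 ^ a) by nra. assert (Db : 1 <= D * 2 ^ b) by nra.
assert (Ew : e * w <= 24 / 100 * w) by (apply Rmult_le_compat_r; lra).
assert (Eh : e * h <= 24 / 100 * h) by (apply Rmult_le_compat_r; lra).
assert (Hww : 2 * phi <= w).
{ apply Rmult_le_reg_l with (4096 * (D * D)); [lra|]. nra. }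
assert (Ha12 : (a <= 12 + k)%nat).
{ apply pow2_le_inv. rewrite pow_add. fold D. replace (2 ^ 12) with 4096 by ring.
  apply Rmult_le_reg_l with D; lra. }
assert (Hb12 : (b <= 12 + k)%nat).
{ apply pow2_le_inv. rewrite pow_add. fold D. replace (2 ^ 12) with 4096 by ring.
  apply Rmult_le_reg_l with D; lra. }
destruct (multiple_above (D * 2 ^ a) x0) as [i0 Hi0]; [lra|lra|].
destruct (multiple_below (D * 2 ^ a) x1) as [i1 Hi1]; [lra|lra|].
destruct (multiple_above (D * 2 ^ b) y0) as [j0 Hj0]; [lra|lra|].
destruct (multiple_below (D * 2 ^ b) y1) as [j1 Hj1]; [lra|lra|].
replace (D * 2 ^ a * INR i0) with (2 ^ a * (D * INR i0)) in Hi0 by ring.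
replace (D * 2 ^ a * INR i1) with (2 ^ a * (D * INR i1)) in Hi1 by ring.
replace (D * 2 ^ b * INR j0) with (2 ^ b * (D * INR j0)) in Hj0 by ring.
replace (D * 2 ^ b * INR j1) with (2 ^ b * (D * INR j1)) in Hj1 by ring.
set (X0 := 2 ^ a * (D * INR i0)) in *. set (X1 := 2 ^ a * (D * INR i1)) in *.
set (Y0 := 2 ^ b * (D * INR j0)) in *. set (Y1 := 2 ^ b * (D * INR j1)) in *.
set (W := X1 - X0 - 2 * (2 ^ a * (3 * D))).
set (H := Y1 - Y0 - 2 * (2 ^ b * (3 * D))).
assert (HW : w * (1 - e) <= W) by (unfold W, w in *; lra).
assert (HH : h * (1 - e) <= H) by (unfold H, h in *; lra).
assert (Hcore : 8192 * (D * D) * (phi - 384 * D) <= W * H).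
{ apply Rle_trans with ((w * (1 - e)) * (h * (1 - e))).
  2:{ apply Rmult_le_compat; nra. }
  apply Rle_trans with ((w * h) * (1 - 2 * e)).
  2:{ assert (0 <= (w * h) * (e * e)) by (apply Rmult_le_pos; nra). lra. }
  replace (phi - 384 * D) with (phi * (1 - 2 * e)) by lra.
  rewrite <- Rmult_assoc. apply Rmult_le_compat_r; lra. }
assert (W76 : 76 / 100 * w <= W) by lra.
assert (H76 : 76 / 100 * h <= H) by lra.
apply fits_mono with (X0 + 2 ^ a * INR 0) (X1 - 2 ^ a * INR 0)
   (Y0 + 2 ^ b * INR 0) (Y1 - 2 ^ b * INR 0); simpl INR; try lra.
change (fits_core k a b i0 i1 j0 j1 0 t).
assert (Bx : X1 <= 4096 * (D * D)) by lra.
assert (By : Y1 <= 4096 * (D * D)) by lra.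
apply fits_chain; fold D; fold X0 X1 Y0 Y1; fold W H; try lra; try easy.
- apply Rle_trans with (2 ^ b * (76 / 100 * w)); [lra|]. apply Rmult_le_compat_l; lra.
- apply Rle_trans with (2 ^ a * (76 / 100 * h)); [lra|]. apply Rmult_le_compat_l; lra.
- apply pow2_cofactor; [|easy]. fold D X0. unfold W in *; nra.
- apply pow2_cofactor; easy.
- apply pow2_cofactor; [|easy]. fold D Y0. unfold H in *; nra.
- apply Nat.neq_0_lt_0, Nat.pow_nonzero; lia.
- intros t' s' Ht' Hst Hs0 Hend. unfold fits_core. fold D; fold X0 X1 Y0 Y1.
  assert (E3 : INR (3 * 2 ^ k) = 3 * D) by (rewrite mult_INR, INR_pow2; simpl; unfold D; ring).
  rewrite E3.
  assert (Ew1 : X1 - 2 ^ a * (3 * D) - (X0 + 2 ^ a * (3 * D)) = W) by (unfold W; ring).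
  assert (Eh1 : Y1 - 2 ^ b * (3 * D) - (Y0 + 2 ^ b * (3 * D)) = H) by (unfold H; ring).
  assert (Hsize : INR s' + INR (size t') = INR (size t)).
  { rewrite <- plus_INR. f_equal. lia. }
  assert (Ps' := pos_INR s').
  assert (Wt : weight k t' = phi - 1200 * INR s').
  { unfold weight; rewrite Ht'. fold D; lra. }
  assert (Pa3 : 0 <= 2 ^ a * (3 * D)) by (apply Rmult_le_pos; lra).
  assert (Pb3 : 0 <= 2 ^ b * (3 * D)) by (apply Rmult_le_pos; lra).
  assert (Qx : 0 <= X0 + 2 ^ a * (3 * D)) by lra.
  assert (Qy : 0 <= Y0 + 2 ^ b * (3 * D)) by lra.
  assert (Qxx : X0 + 2 ^ a * (3 * D) < X1 - 2 ^ a * (3 * D) <= 4096 * (D * D)) by (split; lra).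
  assert (Qyy : Y0 + 2 ^ b * (3 * D) < Y1 - 2 ^ b * (3 * D) <= 4096 * (D * D)) by (split; lra).
  (* A full group has removed at least [1200 * D] from the weight; at a stopping node [fits_stop]
     itself supplies the [384 * D]. *)
  destruct Hend as [Hbig|Hstop].
  + assert (Hs' : D <= INR s') by (unfold D; rewrite <- INR_pow2; now apply le_INR).
    apply IH; [|easy..|].
    * assert (0 < 2 ^ k)%nat by (apply Nat.neq_0_lt_0, Nat.pow_nonzero; lia). lia.
    * rewrite Ew1, Eh1, Wt. apply Rle_trans with (2 := Hcore). apply Rmult_le_compat_l; lra.
  + destruct t' as [|v B L R]; [exact I|].
    apply fits_stop; fold D; [easy|easy| |easy..|].
    * intros u u0 u1 z0 z1 Hu. apply IH. lia.
    * rewrite Ew1, Eh1, Wt. apply Rle_trans with (2 := Hcore). apply Rmult_le_compat_l; lra.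
Qed.

(** The tree weighs at most [1200 * (D * D)], whereas the square of side [4096 * (D * D)] has area
    enough for weight [2048 * (D * D)]. *)
Lemma fits_grid (k : nat) (t : ttree) : (size t <= 4 ^ k)%nat ->
  fits (sparse k) 0 (INR (2 ^ (12 + 2 * k))) 0 (INR (2 ^ (12 + 2 * k))) t.
Proof.
intros Ht.
set (D := 2 ^ k).
assert (PD : 1 <= D) by (apply pow_R1_Rle; lra).
assert (PDD : 1 <= D * D) by nra.
assert (E4 : INR (4 ^ k) = D * D).
{ rewrite pow_INR. unfold D. rewrite <- Rpow_mult_distr. f_equal. simpl; ring. }
assert (EX : INR (2 ^ (12 + 2 * k)) = 4096 * (D * D)).
{ rewrite INR_pow2, pow_add, pow_mult. rewrite <- E4, pow_INR.
  f_equal; [ring|]. f_equal. simpl; ring. }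
rewrite EX.
assert (Hs : INR (size t) <= D * D) by (rewrite <- E4; now apply le_INR).
assert (Hw : weight k t <= 1200 * (D * D)).
{ unfold weight; destruct (heavy k t); fold D; lra. }
apply fits_weight with (size t); fold D; try lra; try easy.
apply Rle_trans with (8192 * (D * D) * (1200 * (D * D))); [apply Rmult_le_compat_l; lra|].
assert (0 <= (D * D) * (D * D)) by nra. lra.
Qed.

(** * Counting grid points *)

Lemma length_flat_map_le {T U} (f : T -> list U) l c :
  (forall x, In x l -> (length (f x) <= c)%nat) -> (length (flat_map f l) <= length l * c)%nat.
Proof.
induction l as [|x l IH]; intros H; simpl; [lia|].
rewrite length_app. assert (K := H x (or_introl eq_refl)).
specialize (IH (fun y Hy => H y (or_intror Hy))). lia.
Qed.

Lemma pow2_pos (a : nat) : (1 <= 2 ^ a)%nat.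
Proof. assert (2 ^ a <> 0)%nat by (apply Nat.pow_nonzero; lia). lia. Qed.

(** Exponents with sum exactly [k] suffice, as surplus powers of two can go into the cofactors. Each
    [a] gives about [2 ^ (24 + 3 * k)] points, so the sum over [a] is the source of the
    logarithm. *)
Definition dyadic_list (k : nat) : list (nat * nat) :=
  flat_map (fun a =>
    list_prod (map (fun i => 2 ^ a * i)%nat (seq 0 (2 ^ (12 + 2 * k - a) + 1)))
              (map (fun j => 2 ^ (k - a) * j)%nat (seq 0 (2 ^ (12 + k + a) + 1))))
    (seq 0 (k + 1)).

Lemma length_dyadic_list (k : nat) : (length (dyadic_list k) <= (k + 1) * (4 * 2 ^ (24 + 3 * k)))%nat.
Proof.
unfold dyadic_list. rewrite <- (length_seq (k + 1) 0) at 2. apply length_flat_map_le.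
intros a Ha%in_seq. rewrite length_prod, !length_map, !length_seq.
replace (24 + 3 * k)%nat with ((12 + 2 * k - a) + (12 + k + a))%nat by lia.
rewrite (Nat.pow_add_r 2 (12 + 2 * k - a)).
assert (H1 := pow2_pos (12 + 2 * k - a)). assert (H2 := pow2_pos (12 + k + a)).
revert H1 H2. generalize (2 ^ (12 + 2 * k - a))%nat, (2 ^ (12 + k + a))%nat. intros u v Hu Hv.
apply Nat.le_trans with (2 * u * (2 * v))%nat; [apply Nat.mul_le_mono|]; lia.
Qed.

Lemma pow2_mul_le_inv (a m i : nat) : (a <= m)%nat -> (2 ^ a * i <= 2 ^ m)%nat -> (i <= 2 ^ (m - a))%nat.
Proof.
intros Ha H. replace m with (a + (m - a))%nat in H by lia. rewrite Nat.pow_add_r in H.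
assert (P := pow2_pos a). now apply Nat.mul_le_mono_pos_l in H.
Qed.

Lemma in_dyadic_list (k x y : nat) : dyadic k x y -> (x <= 2 ^ (12 + 2 * k))%nat ->
  (y <= 2 ^ (12 + 2 * k))%nat -> In (x, y) (dyadic_list k).
Proof.
intros (a & b & i & j & Hab & -> & ->) Hx Hy.
set (a' := min a k).
assert (Ea : (2 ^ a * i = 2 ^ a' * (2 ^ (a - a') * i))%nat).
{ rewrite Nat.mul_assoc, <- Nat.pow_add_r. do 2 f_equal; lia. }
assert (Eb : (2 ^ b * j = 2 ^ (k - a') * (2 ^ (b - (k - a')) * j))%nat).
{ rewrite Nat.mul_assoc, <- Nat.pow_add_r. do 2 f_equal; lia. }
rewrite Ea in *; rewrite Eb in *.
apply in_flat_map; exists a'; split; [apply in_seq; lia|].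
apply in_prod; apply in_map_iff; eexists; split; try reflexivity; apply in_seq.
- apply pow2_mul_le_inv in Hx; lia.
- apply pow2_mul_le_inv in Hy; [|lia].
  replace (12 + k + a')%nat with (12 + 2 * k - (k - a'))%nat by lia. lia.
Qed.

Definition scales (m : nat) : list (nat * nat) :=
  flat_map (fun e => map (fun i => (m - e, i)%nat) (seq 0 (2 ^ e + 1))) (seq 0 (m + 1)).

(** The sum over the scales is geometric, so the diagonals of all scales together cost no factor
    [k]. *)
Lemma length_scales (m : nat) : (length (scales m) <= 3 * 2 ^ m)%nat.
Proof.
unfold scales.
assert (H : forall c q, length (flat_map (fun e => map (fun i => (c - e, i)%nat) (seq 0 (2 ^ e + 1)))
   (seq 0 q)) = (2 ^ q - 1 + q)%nat).
{ intros c q; induction q as [|q IH]; [reflexivity|].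
  rewrite seq_S, flat_map_app, length_app, IH. cbn [flat_map Nat.add].
  rewrite app_nil_r, length_map, length_seq, Nat.pow_succ_r'.
  assert (P := pow2_pos q). lia. }
rewrite H, Nat.add_1_r, Nat.pow_succ_r'.
assert (m < 2 ^ m)%nat by (apply Nat.pow_gt_lin_r; lia). lia.
Qed.

Lemma scales_spec (m a i : nat) : (a <= m)%nat -> (i <= 2 ^ (m - a))%nat -> In (a, i) (scales m).
Proof.
intros Ha Hi. apply in_flat_map; exists (m - a)%nat; split; [apply in_seq; lia|].
apply in_map_iff; exists i; split; [f_equal; lia|apply in_seq; lia].
Qed.

Definition diagonal_list (k : nat) : list (nat * nat) :=
  map (fun z => match z with (((a, i), (b, j)), (s, e)) =>
         ((2 ^ a * (if e : bool then 2 ^ k * i + s else 2 ^ k * i - s))%nat,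
          (2 ^ b * (2 ^ k * j + s))%nat) end)
    (list_prod (list_prod (scales (12 + k)) (scales (12 + k)))
               (list_prod (seq 0 (3 * 2 ^ k + 1)) [true; false])).

Lemma length_diagonal_list (k : nat) : (length (diagonal_list k) <= 72 * 2 ^ (24 + 3 * k))%nat.
Proof.
unfold diagonal_list. rewrite length_map, !length_prod, length_seq.
assert (H := length_scales (12 + k)). cbn [length].
replace (24 + 3 * k)%nat with ((12 + k) + (12 + k) + k)%nat by lia.
rewrite (Nat.pow_add_r 2 (12 + k + (12 + k))), (Nat.pow_add_r 2 (12 + k) (12 + k)).
revert H. assert (P := pow2_pos k). revert P.
generalize (length (scales (12 + k))), (2 ^ (12 + k))%nat, (2 ^ k)%nat.
intros l u d Hd Hl.
apply Nat.le_trans with ((3 * u) * (3 * u) * (4 * d * 2))%nat; [|lia].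
apply Nat.mul_le_mono; [|lia]. now apply Nat.mul_le_mono.
Qed.

Lemma in_diagonal_list (k x y : nat) : diagonal k x y -> In (x, y) (diagonal_list k).
Proof.
intros (a & b & i & j & s & Ha & Hb & Hi & Hj & Hs & Hx & ->).
apply in_map_iff.
destruct Hx as [-> | ->];
  [exists (((a, i), (b, j)), (s, true))|exists (((a, i), (b, j)), (s, false))];
  (split; [reflexivity|]); repeat apply in_prod; try (apply scales_spec; easy);
  simpl; try tauto; apply in_seq; lia.
Qed.

Definition sparse_list (k : nat) : list (nat * nat) :=
  nodup (fun z z' : nat * nat => ltac:(decide equality; apply Nat.eq_dec)) (dyadic_list k ++ diagonal_list k).

Lemma length_sparse_list (k : nat) : (length (sparse_list k) <= (k + 1) * (76 * 2 ^ (24 + 3 * k)))%nat.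
Proof.
unfold sparse_list. eapply Nat.le_trans.
{ apply NoDup_incl_length with (l' := dyadic_list k ++ diagonal_list k); [apply NoDup_nodup|].
  intros z; apply nodup_In. }
rewrite length_app. assert (H1 := length_dyadic_list k). assert (H2 := length_diagonal_list k).
revert H1 H2. generalize (2 ^ (24 + 3 * k))%nat. intros; nia.
Qed.

Lemma in_sparse_list (k x y : nat) : sparse k x y -> (x <= 2 ^ (12 + 2 * k))%nat ->
  (y <= 2 ^ (12 + 2 * k))%nat -> In (x, y) (sparse_list k).
Proof.
intros [H|H] Hx Hy; apply nodup_In, in_app_iff; [left; now apply in_dyadic_list|right; now apply in_diagonal_list].
Qed.

(** * Nested triangles *)

Fixpoint nodes (t : ttree) : list nat :=
  match t with
  | Leaf => []
  | Node v B L R => v :: nodes B ++ nodes L ++ nodes R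
  end.

(** Twice the signed area of the triangle, positive when it is counterclockwise. *)
Definition det (a b c : point) : R :=
  (fst b - fst a) * (snd c - snd a) - (fst c - fst a) * (snd b - snd a).

Definition in_tri (a b c x : point) : Prop :=
  0 < det a b x /\ 0 < det b c x /\ 0 < det c a x.

Lemma in_tri_rot a b c x : in_tri a b c x -> in_tri b c a x.
Proof. unfold in_tri; tauto. Qed.

Lemma in_tri_det a b c x : in_tri a b c x -> 0 < det a b c.
Proof. unfold in_tri, det; intros; lra. Qed.

(** Up to the factor [det a b c], the barycentric coordinates of [x] are the determinants on the
    right, and [det p q] is affine. *)
Lemma det_barycentric a b c p q x :
  det a b c * det p q x =
  det b c x * det p q a + det c a x * det p q b + det a b x * det p q c.
Proof. unfold det; ring. Qed.

(** [x] is a positive combination of [a], [b], [v], and on these [det b c] and [det c a] are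
    nonnegative and not all zero. *)
Lemma in_tri_sub a b c v x : in_tri a b c v -> in_tri a b v x -> in_tri a b c x.
Proof.
intros Hv Hx. assert (Hd := in_tri_det _ _ _ _ Hx). assert (Hc := in_tri_det _ _ _ _ Hv).
destruct Hv as (V1 & V2 & V3); destruct Hx as (X1 & X2 & X3).
split; [exact X1|split].
- assert (E := det_barycentric a b v b c x).
  replace (det b c a) with (det a b c) in E by (unfold det; ring).
  replace (det b c b) with 0 in E by (unfold det; ring).
  apply Rmult_lt_reg_l with (det a b v); [easy|]. rewrite E. nra.
- assert (E := det_barycentric a b v c a x).
  replace (det c a b) with (det a b c) in E by (unfold det; ring).
  replace (det c a a) with 0 in E by (unfold det; ring).
  apply Rmult_lt_reg_l with (det a b v); [easy|]. rewrite E. nra.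
Qed.

(** * Segments that meet only in common endpoints *)

Lemma on_segment_det p q x : on_segment p q x ->
  exists t, 0 <= t <= 1 /\ (forall a b, det a b x = (1 - t) * det a b p + t * det a b q) /\
    (t = 0 -> x = p) /\ (t = 1 -> x = q).
Proof.
intros (t & Ht & E1 & E2); exists t; split; [easy|].
destruct p as [p1 p2]; destruct q as [q1 q2]; destruct x as [x1 x2]; simpl in *.
split; [|split].
- intros a b; unfold det; simpl; rewrite E1, E2; ring.
- intros ->; f_equal; lra.
- intros ->; f_equal; lra.
Qed.

Lemma on_segment_sym p q x : on_segment p q x -> on_segment q p x.
Proof. intros (t & Ht & E1 & E2); exists (1 - t); repeat split; lra. Qed.

Lemma on_segment_in_tri a b c p q x :
  in_tri a b c p -> 0 <= det a b q -> 0 <= det b c q -> 0 <= det c a q ->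
  on_segment p q x -> x = q \/ in_tri a b c x.
Proof.
intros (P1 & P2 & P3) Q1 Q2 Q3 (t & Ht & E & _ & Eq)%on_segment_det.
destruct (Req_dec t 1) as [->|Hn]; [left; now apply Eq|right].
unfold in_tri; rewrite !E. repeat split; nra.
Qed.

Lemma on_segment_det_le0 a b p q x : on_segment p q x ->
  det a b p <= 0 -> det a b q <= 0 -> det a b x <= 0.
Proof. intros (t & Ht & E & _)%on_segment_det; rewrite E; nra. Qed.

(** The condition that [straight_line_embedding] imposes on two different edges. *)
Definition proper (P : nat -> point) (e e' : nat * nat) : Prop :=
  forall x, on_segment (P (fst e)) (P (snd e)) x -> on_segment (P (fst e')) (P (snd e')) x ->
    exists w, (w = fst e \/ w = snd e) /\ (w = fst e' \/ w = snd e') /\ x = P w.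

Lemma proper_sym P e e' : proper P e e' -> proper P e' e.
Proof. intros H x H1 H2; destruct (H x H2 H1) as (w & ? & ? & ?); exists w; tauto. Qed.

Lemma proper_swap P a b e : proper P (a, b) e -> proper P (b, a) e.
Proof.
intros H x H1%on_segment_sym H2; destruct (H x H1 H2) as (w & ? & ? & ?).
exists w; simpl in *; tauto.
Qed.

Lemma proper_common P z a b : det (P z) (P a) (P b) <> 0 -> proper P (z, a) (z, b).
Proof.
intros Hd x (t & Ht & E & E0 & _)%on_segment_det (s & Hs & F & _)%on_segment_det; simpl in *.
exists z; split; [now left|split; [now left|]]. apply E0.
assert (K := F (P z) (P b)). rewrite E in K.
replace (det (P z) (P b) (P z)) with 0 in K by (unfold det; ring).
replace (det (P z) (P b) (P b)) with 0 in K by (unfold det; ring).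
assert (K' : t * det (P z) (P a) (P b) = 0) by (unfold det in *; lra).
apply Rmult_integral in K'; tauto.
Qed.

Lemma proper_disjoint P a b c d :
  0 < det (P c) (P d) (P a) -> 0 < det (P c) (P d) (P b) -> proper P (a, b) (c, d).
Proof.
intros Ha Hb x (t & Ht & E & _)%on_segment_det (s & Hs & F & _)%on_segment_det; simpl in *.
assert (K := F (P c) (P d)). rewrite E in K.
replace (det (P c) (P d) (P c)) with 0 in K by (unfold det; ring).
replace (det (P c) (P d) (P d)) with 0 in K by (unfold det; ring).
nra.
Qed.

Definition k4_edges (a b c v : nat) : list (nat * nat) :=
  [(v, a); (v, b); (v, c); (a, b); (b, c); (c, a)].

Definition same_edge (e e' : nat * nat) : Prop :=
  (fst e = fst e' /\ snd e = snd e') \/ (fst e = snd e' /\ snd e = fst e').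

Ltac proper_common_tac tac :=
  first [ apply proper_common; tac
        | apply proper_swap, proper_common; tac
        | apply proper_sym, proper_swap, proper_common; tac
        | apply proper_swap, proper_sym, proper_swap, proper_common; tac ].

Lemma proper_triangle P a b c e e' : 0 < det (P a) (P b) (P c) ->
  In e [(a, b); (b, c); (c, a)] -> In e' [(a, b); (b, c); (c, a)] ->
  ~ same_edge e e' -> proper P e e'.
Proof.
intros Hd He He' Hne; simpl in He, He'.
destruct He as [<-|[<-|[<-|[]]]]; destruct He' as [<-|[<-|[<-|[]]]];
  try (exfalso; apply Hne; now left);
  proper_common_tac ltac:(unfold det in *; lra).
Qed.

(** Two edges either share an endpoint or are a spoke and the opposite side, and the spoke lies
    strictly on one side of the line through that side. *)
Lemma proper_k4 P a b c v e e' : in_tri (P a) (P b) (P c) (P v) ->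
  In e (k4_edges a b c v) -> In e' (k4_edges a b c v) ->
  ~ same_edge e e' -> proper P e e'.
Proof.
intros Hv He He' Hne. assert (Hd := in_tri_det _ _ _ _ Hv).
destruct Hv as (V1 & V2 & V3). simpl in He, He'.
destruct He as [<-|[<-|[<-|[<-|[<-|[<-|[]]]]]]]; destruct He' as [<-|[<-|[<-|[<-|[<-|[<-|[]]]]]]];
  try (exfalso; apply Hne; now left);
  first [ proper_common_tac ltac:(unfold det in *; lra)
        | apply proper_disjoint; unfold det in *; lra
        | apply proper_sym, proper_disjoint; unfold det in *; lra ].
Qed.

(** The invariant of edges drawn inside a triangle: the segment stays in the open triangle except
    where it ends at a corner. *)
Definition attached (P : nat -> point) (a b c : nat) (e : nat * nat) : Prop :=
  forall x, on_segment (P (fst e)) (P (snd e)) x ->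
    in_tri (P a) (P b) (P c) x \/
    exists z, (z = a \/ z = b \/ z = c) /\ (z = fst e \/ z = snd e) /\ x = P z.

Lemma attached_rot P a b c e : attached P a b c e -> attached P b c a e.
Proof.
intros H x Hx; destruct (H x Hx) as [Hi|(z & Hz & He & E)].
- left; now apply in_tri_rot.
- right; exists z; tauto.
Qed.

Lemma attached_sub P a b c v e : in_tri (P a) (P b) (P c) (P v) ->
  attached P a b v e -> attached P a b c e.
Proof.
intros Hv H x Hx; destruct (H x Hx) as [Hi|(z & Hz & He & E)].
- left; now apply in_tri_sub with (P v).
- destruct Hz as [->|[->| ->]].
  + right; exists a; tauto.
  + right; exists b; tauto.
  + left; now rewrite E.
Qed.

Lemma attached_spoke P a b c v z : in_tri (P a) (P b) (P c) (P v) ->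
  z = a \/ z = b \/ z = c -> attached P a b c (v, z).
Proof.
intros Hv Hz x Hx; simpl in Hx. assert (Hd := in_tri_det _ _ _ _ Hv).
assert (K : x = P z \/ in_tri (P a) (P b) (P c) x).
{ apply on_segment_in_tri with (P v); try easy;
  destruct Hz as [->|[->| ->]]; unfold det in *; lra. }
destruct K as [K|K]; [right; exists z; simpl; tauto|now left].
Qed.

(** The triangles [a b v] and [b c v] lie on different sides of the line through [b] and [v], so the
    segments can meet only in a shared corner. *)
Lemma proper_cross P a b c v e e' : in_tri (P a) (P b) (P c) (P v) ->
  attached P a b v e -> attached P b c v e' -> proper P e e'.
Proof.
intros Hv H H' x Hx Hx'. assert (Hd := in_tri_det _ _ _ _ Hv).
destruct Hv as (V1 & V2 & V3).
destruct (H x Hx) as [(I1 & I2 & I3)|(z & Hz & He & E)];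
  destruct (H' x Hx') as [(J1 & J2 & J3)|(z' & Hz' & He' & E')].
- exfalso; unfold det in *; lra.
- exfalso; rewrite E' in *; destruct Hz' as [->|[->| ->]]; unfold det in *; lra.
- exfalso; rewrite E in *; destruct Hz as [->|[->| ->]]; unfold det in *; lra.
- assert (Ez : z = z').
  { rewrite E in E'.
    destruct Hz as [->|[->| ->]]; destruct Hz' as [->|[->| ->]]; try reflexivity;
      exfalso; rewrite E' in *; unfold det in *; lra. }
  subst z'; exists z; tauto.
Qed.

(** Each edge of the [K_4] lies in a closed half plane that misses the open triangle [a b v], so a
    meeting point is a corner. *)
Lemma proper_mixed P a b c v e e' : in_tri (P a) (P b) (P c) (P v) ->
  attached P a b v e -> In e' (k4_edges a b c v) -> proper P e e'.
Proof.
intros Hv H He' x Hx Hx'. assert (Hd := in_tri_det _ _ _ _ Hv).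
destruct Hv as (V1 & V2 & V3).
assert (Neg : forall p q, det p q p <= 0 /\ det p q q <= 0) by (intros; unfold det; lra).
destruct (H x Hx) as [(I1 & I2 & I3)|(z & Hz & He & E)].
- exfalso.
  assert (K1 := on_segment_det_le0 (P a) (P b) _ _ _ Hx').
  assert (K2 := on_segment_det_le0 (P b) (P v) _ _ _ Hx').
  assert (K3 := on_segment_det_le0 (P v) (P a) _ _ _ Hx').
  simpl in He'.
  destruct He' as [<-|[<-|[<-|[<-|[<-|[<-|[]]]]]]]; simpl in *;
  first [ lapply K1; [intros K; lapply K; [lra|]|]; unfold det in *; lra
        | lapply K2; [intros K; lapply K; [lra|]|]; unfold det in *; lra
        | lapply K3; [intros K; lapply K; [lra|]|]; unfold det in *; lra ].
- exists z; split; [easy|split; [|easy]].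
  destruct (on_segment_det _ _ _ Hx') as (t & Ht & D & _).
  simpl in He'. rewrite E in D.
  destruct He' as [<-|[<-|[<-|[<-|[<-|[<-|[]]]]]]]; simpl in *;
  destruct Hz as [->|[->| ->]]; try tauto; exfalso.
  (* Taking for [p] and [q] the ends of the edge itself makes the right-hand side zero, but a corner
     that is not an end is not collinear with them. *)
  all: match type of D with forall p q, det _ _ _ = _ * det _ _ ?y + _ * det _ _ ?y' =>
         specialize (D y y') end; unfold det in *; lra.
Qed.

(** * Drawing a whole tree in nested triangles *)

Fixpoint edges (l r c : nat) (t : ttree) : list (nat * nat) :=
  match t with
  | Leaf => []
  | Node v B L R =>
      [(v, l); (v, r); (v, c)] ++ edges l r v B ++ edges l v c L ++ edges v r c R
  end.

Fixpoint nested (P : nat -> point) (l r c : nat) (t : ttree) : Prop :=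
  match t with
  | Leaf => True
  | Node v B L R => in_tri (P l) (P r) (P c) (P v) /\
      nested P l r v B /\ nested P l v c L /\ nested P v r c R
  end.

Lemma edges_attached P t : forall l r c e,
  nested P l r c t -> In e (edges l r c t) -> attached P l r c e.
Proof.
induction t as [|v B IHB L IHL R IHR]; intros l r c e; [easy|].
intros (Hv & NB & NL & NR) He. cbn [edges] in He.
assert (Hv1 := in_tri_rot _ _ _ _ Hv). assert (Hv2 := in_tri_rot _ _ _ _ Hv1).
rewrite !in_app_iff in He. destruct He as [He|[He|[He|He]]].
- simpl in He. destruct He as [<-|[<-|[<-|[]]]]; apply attached_spoke; tauto.
- apply attached_sub with v; auto.
- apply attached_rot, attached_sub with v; [easy|]. do 2 apply attached_rot. auto.
- do 2 apply attached_rot. apply attached_sub with v; [easy|]. apply attached_rot. auto.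
Qed.

(** Every edge belongs to the [K_4] on [l], [r], [c], [v] or to one of the three subtrees; up to
    rotating the triangle, each of the sixteen cases is a lemma above or an induction hypothesis. *)
Lemma edges_proper P t : forall l r c e e',
  0 < det (P l) (P r) (P c) -> nested P l r c t ->
  In e (edges l r c t ++ [(l, r); (r, c); (c, l)]) ->
  In e' (edges l r c t ++ [(l, r); (r, c); (c, l)]) ->
  ~ same_edge e e' -> proper P e e'.
Proof.
induction t as [|v B IHB L IHL R IHR]; intros l r c e e' Hd.
{ intros _; simpl app; now apply proper_triangle. }
intros (Hv & NB & NL & NR) He He' Hne.
assert (Hv1 := in_tri_rot _ _ _ _ Hv). assert (Hv2 := in_tri_rot _ _ _ _ Hv1).
assert (split_edges : forall e, In e (edges l r c (Node v B L R) ++ [(l, r); (r, c); (c, l)]) ->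
  In e (k4_edges l r c v) \/ In e (edges l r v B) \/ In e (edges l v c L) \/ In e (edges v r c R)).
{ intros f Hf. cbn [edges] in Hf. rewrite !in_app_iff in Hf. simpl in *. tauto. }
assert (kr : forall e, In e (k4_edges l r c v) -> In e (k4_edges r c l v)) by (simpl; tauto).
assert (kr2 : forall e, In e (k4_edges l r c v) -> In e (k4_edges c l r v)) by (simpl; tauto).
assert (aB : forall e, In e (edges l r v B) -> attached P l r v e).
{ intros; now apply edges_attached with B. }
assert (aL : forall e, In e (edges l v c L) -> attached P c l v e).
{ intros; do 2 apply attached_rot; now apply edges_attached with L. }
assert (aR : forall e, In e (edges v r c R) -> attached P r c v e).
{ intros; apply attached_rot; now apply edges_attached with R. }
destruct Hv as (V1 & V2 & V3).
apply split_edges in He; apply split_edges in He'.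
destruct He as [He|[He|[He|He]]]; destruct He' as [He'|[He'|[He'|He']]].
- now apply proper_k4 with l r c v.
- apply proper_sym, proper_mixed with l r c v; auto. now split.
- apply proper_sym, proper_mixed with c l r v; auto.
- apply proper_sym, proper_mixed with r c l v; auto.
- apply proper_mixed with l r c v; auto. now split.
- apply IHB with l r v; try rewrite in_app_iff; auto; lra.
- apply proper_sym, proper_cross with c l r v; auto.
- apply proper_cross with l r c v; auto. now split.
- apply proper_mixed with c l r v; auto.
- apply proper_cross with c l r v; auto.
- apply IHL with l v c; try rewrite in_app_iff; auto. unfold det in *; lra.
- apply proper_sym, proper_cross with r c l v; auto.
- apply proper_mixed with r c l v; auto.
- apply proper_sym, proper_cross with l r c v; auto. now split.
- apply proper_cross with r c l v; auto.
- apply IHR with v r c; try rewrite in_app_iff; auto. unfold det in *; lra.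
Qed.

Lemma nodes_in_tri P t : forall l r c u,
  nested P l r c t -> In u (nodes t) -> in_tri (P l) (P r) (P c) (P u).
Proof.
induction t as [|v B IHB L IHL R IHR]; intros l r c u; [easy|].
intros (Hv & NB & NL & NR) Hu. simpl in Hu. rewrite !in_app_iff in Hu.
assert (Hv1 := in_tri_rot _ _ _ _ Hv). assert (Hv2 := in_tri_rot _ _ _ _ Hv1).
destruct Hu as [<-|[Hu|[Hu|Hu]]]; [easy|..].
- apply in_tri_sub with (P v); auto.
- apply in_tri_rot, in_tri_sub with (P v); [easy|]. do 2 apply in_tri_rot; auto.
- do 2 apply in_tri_rot; apply in_tri_sub with (P v); [easy|]. apply in_tri_rot; auto.
Qed.

Lemma nested_inj P t : forall l r c u w,
  0 < det (P l) (P r) (P c) -> nested P l r c t ->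
  In u ([l; r; c] ++ nodes t) -> In w ([l; r; c] ++ nodes t) -> P u = P w -> u = w.
Proof.
assert (corner : forall l r c z u, nested P l r c t -> In u (nodes t) -> In z [l; r; c] -> P u <> P z).
{ intros l r c z u Hn Hu Hz E. assert (K := nodes_in_tri P t l r c u Hn Hu). rewrite E in K.
  destruct K as (K1 & K2 & K3).
  destruct Hz as [<-|[<-|[<-|[]]]]; unfold det in *; lra. }
assert (inner : forall l r c u w, nested P l r c t -> In u (nodes t) -> In w (nodes t) ->
          P u = P w -> u = w).
{ clear corner; induction t as [|v B IHB L IHL R IHR]; intros l r c u w; [easy|].
  intros (Hv & NB & NL & NR) Hu Hw E. simpl in Hu, Hw. rewrite !in_app_iff in Hu, Hw.
  assert (iB := fun u => nodes_in_tri P B l r v u NB).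
  assert (iL := fun u => nodes_in_tri P L l v c u NL).
  assert (iR := fun u => nodes_in_tri P R v r c u NR).
  assert (Iu : u = v \/ In u (nodes B) \/ In u (nodes L) \/ In u (nodes R)) by intuition congruence.
  assert (Iw : w = v \/ In w (nodes B) \/ In w (nodes L) \/ In w (nodes R)) by intuition congruence.
  clear Hu Hw.
  destruct Iu as [->|[Hu|[Hu|Hu]]]; destruct Iw as [->|[Hw|[Hw|Hw]]]; try reflexivity;
  try (apply (IHB l r v); assumption); try (apply (IHL l v c); assumption);
  try (apply (IHR v r c); assumption);
  exfalso;
  try (first [apply iB in Hu | apply iL in Hu | apply iR in Hu]);
  try (first [apply iB in Hw | apply iL in Hw | apply iR in Hw]);
  try rewrite E in *; try rewrite <- E in *; unfold in_tri, det in *; lra. }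
intros l r c u w Hd Hn Hu Hw E.
apply in_app_or in Hu; apply in_app_or in Hw.
destruct Hu as [Hu|Hu]; destruct Hw as [Hw|Hw].
- simpl in Hu, Hw.
  destruct Hu as [<-|[<-|[<-|[]]]]; destruct Hw as [<-|[<-|[<-|[]]]]; try reflexivity;
  exfalso; rewrite E in *; unfold det in *; lra.
- exfalso; now apply (corner l r c u w).
- exfalso; now apply (corner l r c w u).
- now apply (inner l r c).
Qed.

(** The row of the apex dominates: the determinant is at least [z - M * (u + v)], where [z] is at
    least [2 * M + 1] times each of [u] and [v]. *)
Lemma det_grid_pos (M : nat) (xl yl xr yr xc yc : nat) : (1 <= M)%nat ->
  (xl <= M)%nat -> (xr <= M)%nat -> (xc <= M)%nat ->
  (xl < xr)%nat -> (yl < yc)%nat -> (yr < yc)%nat ->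
  let g := fun x y : nat => (INR x, (2 * INR M + 1) ^ y) in
  0 < det (g xl yl) (g xr yr) (g xc yc).
Proof.
intros HM Hl Hr Hc Hlr Hlc Hrc g; unfold g, det; simpl.
set (b := 2 * INR M + 1).
apply le_INR in HM, Hl, Hr, Hc. simpl in HM.
assert (Hx : INR xl + 1 <= INR xr) by (rewrite <- S_INR; now apply le_INR).
assert (Pxl := pos_INR xl). assert (Pxc := pos_INR xc). assert (Pxr := pos_INR xr).
assert (Hb : 1 <= b) by (unfold b; lra).
assert (pow_step : forall i j, (i < j)%nat -> b * b ^ i <= b ^ j).
{ intros i j Hij. change (b * b ^ i) with (b ^ S i). now apply Rle_pow. }
assert (Kl := pow_step _ _ Hlc). assert (Kr := pow_step _ _ Hrc).
assert (Pl : 0 < b ^ yl) by (apply pow_lt; lra).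
assert (Pr : 0 < b ^ yr) by (apply pow_lt; lra).
set (u := b ^ yl) in *; set (v := b ^ yr) in *; set (z := b ^ yc) in *.
replace ((INR xr - INR xl) * (z - u) - (INR xc - INR xl) * (v - u))
  with ((INR xr - INR xl) * z - (INR xc - INR xl) * v + (INR xc - INR xr) * u) by ring.
assert (Pz : 0 < z) by nra.
assert (A1 : z <= (INR xr - INR xl) * z) by nra.
assert (A2 : (INR xc - INR xl) * v <= INR M * v) by nra.
assert (A3 : - (INR M * u) <= (INR xc - INR xr) * u) by nra.
unfold b in Kl, Kr; nra.
Qed.

(** * Insertion trees *)

Fixpoint fits_at (S : nat -> nat -> Prop) (pos : nat -> nat * nat) (x0 x1 y0 y1 : R)
    (t : ttree) : Prop :=
  match t with
  | Leaf => True
  | Node v B L R =>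
      let x := fst (pos v) in let y := snd (pos v) in
      S x y /\ x0 < INR x < x1 /\ y0 < INR y < y1 /\
      fits_at S pos x0 x1 y0 (INR y) B /\
      fits_at S pos x0 (INR x) (INR y) y1 L /\
      fits_at S pos (INR x) x1 (INR y) y1 R
  end.

Lemma fits_at_ext S pos pos' t : (forall u, In u (nodes t) -> pos u = pos' u) ->
  forall x0 x1 y0 y1, fits_at S pos x0 x1 y0 y1 t -> fits_at S pos' x0 x1 y0 y1 t.
Proof.
induction t as [|v B IHB L IHL R IHR]; intros E x0 x1 y0 y1; [easy|].
simpl in E |- *. rewrite (E v) by now left.
intros (H1 & H2 & H3 & FB & FL & FR).
split; [easy|split; [easy|split; [easy|]]].
split; [apply IHB|split; [apply IHL|apply IHR]]; try easy;
  intros u Hu; apply E; rewrite !in_app_iff; tauto.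
Qed.

Lemma NoDup_app_inv {T} (l l' : list T) :
  NoDup (l ++ l') -> NoDup l /\ NoDup l' /\ forall x, In x l -> ~ In x l'.
Proof.
induction l as [|y l IH]; simpl; intros H; [repeat split; [constructor|easy|easy]|].
apply NoDup_cons_iff in H. destruct H as [Hy H]. rewrite in_app_iff in Hy.
destruct (IH H) as (H1 & H2 & H3).
split; [constructor; tauto|split; [easy|]].
intros x [<-|Hx]; [tauto|now apply H3].
Qed.

(** The positions are chosen subtree by subtree; [NoDup] keeps a later choice from overwriting an
    earlier one. *)
Lemma fits_positions S t : forall x0 x1 y0 y1,
  fits S x0 x1 y0 y1 t -> NoDup (nodes t) ->
  forall pos0, exists pos, (forall u, ~ In u (nodes t) -> pos u = pos0 u) /\
    fits_at S pos x0 x1 y0 y1 t.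
Proof.
induction t as [|v B IHB L IHL R IHR]; intros x0 x1 y0 y1 Hf Hd pos0.
{ exists pos0; easy. }
destruct Hf as (x & y & HS & Hx & Hy & FB & FL & FR).
simpl in Hd. apply NoDup_cons_iff in Hd. destruct Hd as [Hv Hd].
apply NoDup_app_inv in Hd. destruct Hd as (DB & Hd & XB).
apply NoDup_app_inv in Hd. destruct Hd as (DL & DR & XL).
rewrite !in_app_iff in Hv.
destruct (IHB _ _ _ _ FB DB (fun u => if Nat.eq_dec u v then (x, y) else pos0 u))
  as (pB & EB & GB).
destruct (IHL _ _ _ _ FL DL pB) as (pL & EL & GL).
destruct (IHR _ _ _ _ FR DR pL) as (pR & ER & GR).
assert (Ev : pR v = (x, y)).
{ rewrite ER, EL, EB by tauto. destruct (Nat.eq_dec v v); easy. }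
exists pR; split.
- intros u Hu. simpl in Hu. rewrite !in_app_iff in Hu.
  rewrite ER, EL, EB by tauto. destruct (Nat.eq_dec u v); [subst; tauto|easy].
- simpl. rewrite Ev; simpl.
  split; [easy|split; [easy|split; [easy|split; [|split; [|easy]]]]].
  + revert GB; apply fits_at_ext. intros u Hu.
    specialize (XB u Hu). rewrite in_app_iff in XB.
    rewrite ER, EL; [easy|tauto..].
  + revert GL; apply fits_at_ext. intros u Hu.
    specialize (XL u Hu). rewrite ER; easy.
Qed.

Definition grid_point (M : nat) (z : nat * nat) : point :=
  (INR (fst z), (2 * INR M + 1) ^ snd z).

Lemma fits_at_nested S pos M t : (1 <= M)%nat -> forall x0 x1 y0 y1 l r c,
  fits_at S pos x0 x1 y0 y1 t ->
  INR (fst (pos l)) <= x0 -> x1 <= INR (fst (pos r)) ->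
  INR (snd (pos l)) <= y0 -> INR (snd (pos r)) <= y0 -> y1 <= INR (snd (pos c)) ->
  (fst (pos l) <= M)%nat -> (fst (pos r) <= M)%nat -> (fst (pos c) <= M)%nat ->
  nested (fun u => grid_point M (pos u)) l r c t.
Proof.
intros HM; induction t as [|v B IHB L IHL R IHR]; intros x0 x1 y0 y1 l r c; [easy|].
intros (HS & Hx & Hy & FB & FL & FR) Hl Hr Yl Yr Yc Ml Mr Mc.
assert (Lv : (fst (pos l) < fst (pos v))%nat) by (apply INR_lt; lra).
assert (Vr : (fst (pos v) < fst (pos r))%nat) by (apply INR_lt; lra).
assert (Ylv : (snd (pos l) < snd (pos v))%nat) by (apply INR_lt; lra).
assert (Yrv : (snd (pos r) < snd (pos v))%nat) by (apply INR_lt; lra).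
assert (Yvc : (snd (pos v) < snd (pos c))%nat) by (apply INR_lt; lra).
assert (Mv : (fst (pos v) <= M)%nat) by lia.
split; [|split; [|split]].
- assert (K1 : 0 < det (grid_point M (pos l)) (grid_point M (pos r)) (grid_point M (pos v)))
    by (apply det_grid_pos; lia).
  assert (K2 : 0 < det (grid_point M (pos v)) (grid_point M (pos r)) (grid_point M (pos c)))
    by (apply det_grid_pos; lia).
  assert (K3 : 0 < det (grid_point M (pos l)) (grid_point M (pos v)) (grid_point M (pos c)))
    by (apply det_grid_pos; lia).
  unfold in_tri, det in *; lra.
- eapply IHB; [exact FB|lra..| | |]; easy.
- eapply IHL; [exact FL|lra..| | |]; easy.
- eapply IHR; [exact FR|lra..| | |]; easy.
Qed.

Lemma fits_at_mem S pos t u : forall x0 x1 y0 y1,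
  fits_at S pos x0 x1 y0 y1 t -> In u (nodes t) ->
  S (fst (pos u)) (snd (pos u)) /\ INR (fst (pos u)) < x1 /\ INR (snd (pos u)) < y1.
Proof.
induction t as [|v B IHB L IHL R IHR]; intros x0 x1 y0 y1; [easy|].
intros (HS & Hx & Hy & FB & FL & FR) Hu. simpl in Hu. rewrite !in_app_iff in Hu.
destruct Hu as [<-|[Hu|[Hu|Hu]]]; [split; [easy|lra]|..].
- destruct (IHB _ _ _ _ FB Hu); split; [easy|lra].
- destruct (IHL _ _ _ _ FL Hu); split; [easy|lra].
- destruct (IHR _ _ _ _ FR Hu); split; [easy|lra].
Qed.

Section InsertionTree.

Variable n : nat.
Variable A : nat -> nat -> Prop.

(** Vertices are named by their place in the insertion order, and the triangle is described by its
    set of corners, in any order. *)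
Definition hangs_on (u a b c : nat) : Prop :=
  (3 <= u < n)%nat /\ forall m, ((m < u)%nat /\ A u m) <-> (m = a \/ m = b \/ m = c).

Hypothesis hangs_on_exists : forall u, (3 <= u < n)%nat ->
  exists i j l, (i < j < l)%nat /\ A l i /\ A l j /\ hangs_on u i j l.
Hypothesis hangs_on_unique : forall u u' a b c, hangs_on u a b c -> hangs_on u' a b c -> u = u'.

Lemma hangs_on_lt u a b c : hangs_on u a b c -> (a < u /\ b < u /\ c < u)%nat.
Proof.
intros [_ H]; split; [|split]; apply H; tauto.
Qed.

Lemma hangs_on_perm u a b c a' b' c' : hangs_on u a b c ->
  (forall m, (m = a \/ m = b \/ m = c) <-> (m = a' \/ m = b' \/ m = c')) -> hangs_on u a' b' c'.
Proof. intros [H0 H] E; split; [easy|]. intros m; rewrite H; apply E. Qed.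

(** A relation, because [A] need not be decidable; a tree is obtained classically. *)
Inductive tree_of (a b c : nat) : ttree -> Prop :=
| tree_leaf : (forall u, ~ hangs_on u a b c) -> tree_of a b c Leaf
| tree_node u B L R : hangs_on u a b c -> tree_of a b u B -> tree_of a u c L ->
    tree_of u b c R -> tree_of a b c (Node u B L R).

Lemma tree_of_exists a b c : exists t, tree_of a b c t.
Proof.
(* Each insertion raises the largest corner, which stays below [n], so [m] bounds the remaining
   depth. *)
assert (H : forall m a b c, (n <= max a (max b c) + m)%nat -> exists t, tree_of a b c t).
2:{ apply (H n). lia. }
clear a b c; induction m as [|m IH]; intros a b c Hm;
  (destruct (classic (exists u, hangs_on u a b c)) as [[u Hu]|Hn];
   [|exists Leaf; constructor; intros u Hu; apply Hn; now exists u]);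
  destruct (hangs_on_lt _ _ _ _ Hu) as (Ha & Hb & Hc); assert (Hun := proj1 Hu).
- lia.
- destruct (IH a b u) as [B HB]; [lia|].
  destruct (IH a u c) as [L HL]; [lia|].
  destruct (IH u b c) as [R HR]; [lia|].
  exists (Node u B L R); now constructor.
Qed.

Lemma tree_of_nodes_gt a b c t : tree_of a b c t ->
  forall u, In u (nodes t) -> (a < u /\ b < u /\ c < u /\ 3 <= u < n)%nat.
Proof.
induction 1 as [|a b c u B L R Hu _ IHB _ IHL _ IHR]; [easy|].
intros w Hw; simpl in Hw; rewrite !in_app_iff in Hw.
destruct (hangs_on_lt _ _ _ _ Hu) as (? & ? & ?). assert (Hun := proj1 Hu).
destruct Hw as [<-|[Hw|[Hw|Hw]]].
- lia.
- specialize (IHB w Hw); lia.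
- specialize (IHL w Hw); lia.
- specialize (IHR w Hw); lia.
Qed.

Lemma tree_of_parent a b c t : tree_of a b c t -> forall w, In w (nodes t) ->
  hangs_on w a b c \/
  exists p q r, In p (nodes t) /\ hangs_on w p q r /\ (q < p)%nat /\ (r < p)%nat.
Proof.
induction 1 as [|a b c u B L R Hu _ IHB _ IHL _ IHR]; [easy|].
intros w Hw; simpl in Hw; rewrite !in_app_iff in Hw.
destruct (hangs_on_lt _ _ _ _ Hu) as (? & ? & ?).
destruct Hw as [<-|[Hw|[Hw|Hw]]]; [now left|right..].
- destruct (IHB w Hw) as [K|(p & q & r & Hp & K)].
  + exists u, a, b; split; [now left|split; [|easy]].
    apply (hangs_on_perm _ _ _ _ _ _ _ K); tauto.
  + exists p, q, r; simpl; rewrite !in_app_iff; tauto.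
- destruct (IHL w Hw) as [K|(p & q & r & Hp & K)].
  + exists u, a, c; split; [now left|split; [|easy]].
    apply (hangs_on_perm _ _ _ _ _ _ _ K); tauto.
  + exists p, q, r; simpl; rewrite !in_app_iff; tauto.
- destruct (IHR w Hw) as [K|(p & q & r & Hp & K)].
  + exists u, b, c; split; [now left|split; [|easy]].
    apply (hangs_on_perm _ _ _ _ _ _ _ K); tauto.
  + exists p, q, r; simpl; rewrite !in_app_iff; tauto.
Qed.

Lemma hangs_on_same u a b c a' b' c' m : hangs_on u a b c -> hangs_on u a' b' c' ->
  (m = a \/ m = b \/ m = c) -> (m = a' \/ m = b' \/ m = c').
Proof. intros [_ H] [_ H'] Hm; apply H', H, Hm. Qed.

(* A common node of two subtrees would have the same last-inserted corner in both, a smaller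
   common node, unless it is attached to both root triangles. *)
Lemma tree_of_disjoint k z a b c a' b' c' t t' :
  tree_of a b c t -> tree_of a' b' c' t' ->
  (k = a \/ k = b \/ k = c) -> (k = a' \/ k = b' \/ k = c') ->
  (a <= k /\ b <= k /\ c <= k)%nat -> (a' <= k /\ b' <= k /\ c' <= k)%nat ->
  (z = a \/ z = b \/ z = c) -> ~ (z = a' \/ z = b' \/ z = c') ->
  forall w, In w (nodes t) -> ~ In w (nodes t').
Proof.
intros Ht Ht' Hk Hk' Hle Hle' Hz Hz' w.
induction w as [w IH] using (well_founded_induction lt_wf); intros Hw Hw'.
destruct (tree_of_parent _ _ _ _ Ht w Hw) as [K|(p & q & r & Hp & K & Hq & Hr)];
  destruct (tree_of_parent _ _ _ _ Ht' w Hw') as [K'|(p' & q' & r' & Hp' & K' & Hq' & Hr')].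
- apply Hz'. exact (hangs_on_same _ _ _ _ _ _ _ z K K' Hz).
- assert (G := tree_of_nodes_gt _ _ _ _ Ht' p' Hp').
  assert (P := hangs_on_same _ _ _ _ _ _ _ p' K' K (or_introl eq_refl)). lia.
- assert (G := tree_of_nodes_gt _ _ _ _ Ht p Hp).
  assert (P := hangs_on_same _ _ _ _ _ _ _ p K K' (or_introl eq_refl)). lia.
- assert (P := hangs_on_same _ _ _ _ _ _ _ p' K' K (or_introl eq_refl)).
  assert (P' := hangs_on_same _ _ _ _ _ _ _ p K K' (or_introl eq_refl)).
  assert (p = p') by lia. subst p'.
  apply (IH p); [|easy|easy]. now destruct (hangs_on_lt _ _ _ _ K).
Qed.

Lemma tree_of_NoDup a b c t : tree_of a b c t -> a <> b -> b <> c -> a <> c -> NoDup (nodes t).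
Proof.
induction 1 as [|a b c u B L R Hu TB IHB TL IHL TR IHR]; intros Hab Hbc Hac; [constructor|].
destruct (hangs_on_lt _ _ _ _ Hu) as (? & ? & ?). simpl.
constructor.
- rewrite !in_app_iff. intros [K|[K|K]].
  + specialize (tree_of_nodes_gt _ _ _ _ TB u K); lia.
  + specialize (tree_of_nodes_gt _ _ _ _ TL u K); lia.
  + specialize (tree_of_nodes_gt _ _ _ _ TR u K); lia.
- apply NoDup_app; [apply IHB; lia| |].
  + apply NoDup_app; [apply IHL; lia|apply IHR; lia|].
    apply (tree_of_disjoint u a _ _ _ _ _ _ _ _ TL TR); lia.
  + intros w Hw; rewrite in_app_iff; intros [K|K]; revert w Hw K.
    * apply (tree_of_disjoint u b _ _ _ _ _ _ _ _ TB TL); lia.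
    * apply (tree_of_disjoint u a _ _ _ _ _ _ _ _ TB TR); lia.
Qed.

Lemma tree_of_root a b c t w : tree_of a b c t -> hangs_on w a b c -> In w (nodes t).
Proof.
intros [Hn|u B L R Hu _ _ _] Hw; [now apply Hn in Hw|].
left; now apply hangs_on_unique with a b c.
Qed.

(** The older neighbours [q], [r] of [p] are corners of the triangle that [p] hangs on, so [p], [q],
    [r] is one of the faces created by [p]; by uniqueness [w] is the root of its subtree. *)
Lemma tree_of_child a b c t : tree_of a b c t -> forall p q r w,
  In p (nodes t) -> hangs_on w p q r -> (q < p)%nat -> (r < p)%nat -> A p q -> A p r -> q <> r ->
  In w (nodes t).
Proof.
induction 1 as [|a b c u B L R Hu TB IHB TL IHL TR IHR]; intros p q r w; [easy|].
intros Hp Hw Hq Hr Aq Ar Hqr; simpl in Hp |- *; rewrite !in_app_iff in *.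
destruct Hp as [<-|[Hp|[Hp|Hp]]].
- assert (Mq := proj1 (proj2 Hu q) (conj Hq Aq)).
  assert (Mr := proj1 (proj2 Hu r) (conj Hr Ar)).
  assert (K : (forall m, (m = u \/ m = q \/ m = r) <-> (m = a \/ m = b \/ m = u)) \/
    (forall m, (m = u \/ m = q \/ m = r) <-> (m = a \/ m = u \/ m = c)) \/
    (forall m, (m = u \/ m = q \/ m = r) <-> (m = u \/ m = b \/ m = c))).
  { destruct Mq as [->|[->| ->]]; destruct Mr as [->|[->| ->]]; try easy;
    solve [left; tauto | right; left; tauto | right; right; tauto]. }
  destruct K as [K|[K|K]]; apply (hangs_on_perm _ _ _ _ _ _ _ Hw) in K.
  + right; left; now apply (tree_of_root _ _ _ _ _ TB).
  + right; right; left; now apply (tree_of_root _ _ _ _ _ TL).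
  + right; right; right; now apply (tree_of_root _ _ _ _ _ TR).
- right; left; eapply IHB; eassumption.
- right; right; left; eapply IHL; eassumption.
- right; right; right; eapply IHR; eassumption.
Qed.

(** Descent to the last inserted corner [l] of the triangle of [w]: it is a node already, or the
    triangle is the initial one. *)
Lemma tree_of_cover t : tree_of 0 1 2 t -> forall w, (3 <= w < n)%nat -> In w (nodes t).
Proof.
intros Ht w; induction w as [w IH] using (well_founded_induction lt_wf); intros Hw.
destruct (hangs_on_exists w Hw) as (i & j & l & Hijl & Ai & Aj & Hatt).
destruct (hangs_on_lt _ _ _ _ Hatt) as (_ & _ & Hl).
destruct (Nat.le_gt_cases 3 l) as [H3|H3].
- apply (tree_of_child _ _ _ _ Ht l i j w); try easy; try lia.
  + apply IH; lia.
  + apply (hangs_on_perm _ _ _ _ _ _ _ Hatt); tauto.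
- apply (tree_of_root _ _ _ _ _ Ht).
  assert (i = 0 /\ j = 1 /\ l = 2)%nat as (-> & -> & ->) by lia. exact Hatt.
Qed.

Lemma tree_of_edges a b c t : tree_of a b c t -> forall w m,
  In w (nodes t) -> (m < w)%nat -> A w m -> In (w, m) (edges a b c t).
Proof.
induction 1 as [|a b c u B L R Hu TB IHB TL IHL TR IHR]; intros w m; [easy|].
intros Hw Hm Hwm; simpl in Hw; cbn [edges]; rewrite !in_app_iff in *.
destruct Hw as [<-|[Hw|[Hw|Hw]]].
- destruct (proj1 (proj2 Hu m) (conj Hm Hwm)) as [->|[->| ->]]; left; simpl; tauto.
- right; left; now apply IHB.
- right; right; left; now apply IHL.
- right; right; right; now apply IHR.
Qed.

Lemma tree_of_size t : tree_of 0 1 2 t -> (size t <= n)%nat.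
Proof.
intros Ht.
assert (E : forall u, size u = length (nodes u)).
{ induction u as [|v B IHB L IHL R IHR]; simpl; [easy|]. rewrite !length_app; lia. }
rewrite E, <- (length_seq n 0).
apply NoDup_incl_length; [now apply tree_of_NoDup with 0%nat 1%nat 2%nat|].
intros u Hu%(tree_of_nodes_gt _ _ _ _ Ht). apply in_seq; lia.
Qed.

End InsertionTree.

(** * The theorem *)

Lemma pow4_above (n : nat) : (1 <= n)%nat -> exists k, (n <= 4 ^ k /\ 4 ^ k <= 4 * n)%nat.
Proof.
induction n as [|n IH]; intros Hn; [lia|].
destruct (Nat.eq_dec n 0) as [->|H0]; [exists 0%nat; simpl; lia|].
destruct IH as (k & H1 & H2); [lia|].
destruct (Nat.eq_dec n (4 ^ k)) as [E|E].
- exists (S k); rewrite Nat.pow_succ_r'; lia.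
- exists k; lia.
Qed.

Lemma ln_le (x y : R) : 0 < x -> x <= y -> ln x <= ln y.
Proof.
intros Hx [H| ->]; [left; now apply ln_increasing|right; reflexivity].
Qed.

Lemma size_bound (n k : nat) : (3 <= n)%nat -> (4 ^ k <= 4 * n)%nat ->
  INR ((k + 1) * (76 * 2 ^ (24 + 3 * k))) <=
  1824 * 2 ^ 24 * Rpower (INR n) (3 / 2) * ln (INR n).
Proof.
intros Hn Hk.
set (x := INR n). assert (Hx : 3 <= x).
{ unfold x. apply le_INR in Hn. simpl in Hn. lra. }
set (D := 2 ^ k).
assert (HD : 1 <= D) by (apply pow_R1_Rle; lra).
assert (EDD : 4 ^ k = D * D) by (unfold D; rewrite <- Rpow_mult_distr; f_equal; ring).
assert (H4 : D * D <= 4 * x).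
{ rewrite <- EDD. apply le_INR in Hk. rewrite pow_INR, mult_INR in Hk.
  replace (INR 4) with 4 in Hk by (simpl; ring). exact Hk. }
assert (Eq : Rpower x (3 / 2) = x * sqrt x).
{ replace (3 / 2) with (1 + / 2) by field. rewrite Rpower_plus, Rpower_1, Rpower_sqrt; lra. }
assert (Hsq : 0 <= sqrt x) by apply sqrt_pos.
assert (Hsqx : sqrt x * sqrt x = x) by (apply sqrt_sqrt; lra).
assert (Hs : D <= 2 * sqrt x) by nra.
assert (Hcube : D * (D * D) <= 8 * (x * sqrt x)) by nra.
assert (Hln1 : 1 <= ln x).
{ rewrite <- (ln_exp 1). apply ln_le; [apply exp_pos|]. assert (K := exp_le_3). lra. }
assert (Hln4 : 1 <= ln 4).
{ rewrite <- (ln_exp 1). apply ln_le; [apply exp_pos|]. assert (K := exp_le_3). lra. }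
assert (Hk1 : INR k * ln 4 <= ln 4 + ln x).
{ rewrite <- ln_mult, <- ln_pow by lra. apply ln_le; [apply pow_lt; lra|]. lra. }
(* For [k > 1], [1 <= ln 4] gives [k - 1 <= ln x], and [1 <= ln x] absorbs the remaining 2. *)
assert (Hk2 : INR k + 1 <= 3 * ln x).
{ destruct (Rle_dec (INR k) 1) as [H1|H1]; [lra|]. nra. }
rewrite mult_INR, plus_INR, mult_INR, INR_pow2, pow_add, pow_mult.
replace ((2 ^ 3) ^ k) with (D * (D * D)).
2:{ unfold D. rewrite <- !Rpow_mult_distr. f_equal; ring. }
replace (INR 76) with 76 by (simpl; ring). rewrite Eq.
replace (INR 1) with 1 by reflexivity.
assert (P24 : 0 < 2 ^ 24) by (apply pow_lt; lra).
set (c := 2 ^ 24) in *.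
(* Here [1824 = 3 * 76 * 8], with 3 from [Hk2] and 8 from [D <= 2 * sqrt x] cubed. *)
apply Rle_trans with ((3 * ln x) * (76 * (c * (8 * (x * sqrt x))))); [|lra].
assert (0 <= D * (D * D)) by nra.
assert (Pk := pos_INR k).
apply Rmult_le_compat; [lra| |lra|].
- apply Rmult_le_pos; [lra|]. apply Rmult_le_pos; lra.
- apply Rmult_le_compat_l; [lra|]. apply Rmult_le_compat_l; lra.
Qed.

Lemma grid_point_inj (M : nat) z z' : (1 <= M)%nat -> grid_point M z = grid_point M z' -> z = z'.
Proof.
intros HM%le_INR; simpl in HM. destruct z as [x y]; destruct z' as [x' y'].
unfold grid_point; simpl; intros [= Ex Ey]. apply INR_eq in Ex. f_equal; [easy|].
assert (mono : forall i j, (i < j)%nat -> (2 * INR M + 1) ^ i < (2 * INR M + 1) ^ j).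
{ intros; apply Rlt_pow; [lra|easy]. }
destruct (Nat.lt_trichotomy y y') as [H|[H|H]]; [|easy|]; apply mono in H; lra.
Qed.

Lemma dyadic_multiple (k i j : nat) : dyadic k (2 ^ k * i) j.
Proof. exists k, 0%nat, i, j; simpl; lia. Qed.

Lemma embedding_exists (k n : nat) (E : nat -> nat -> Prop) :
  (n <= 4 ^ k)%nat -> planar_3_tree n E ->
  exists p, straight_line_embedding n E p /\
    forall v, (v < n)%nat -> In (p v) (map (grid_point (2 ^ (12 + 2 * k))) (sparse_list k)).
Proof.
intros Hnk ((Ebound & Esym & Eirr) & Hn3 & s & Hperm & E01 & E12 & E02 & Hatt & Huniq).
set (v := fun i => nth i s 0%nat) in *.
set (A := fun i j => E (v i) (v j)).
assert (Hlen : length s = n) by (rewrite (Permutation_length Hperm); apply length_seq).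
assert (Hnodup : NoDup s) by (apply (Permutation_NoDup (Permutation_sym Hperm)), seq_NoDup).
(* The inverse of the insertion order, which carries the drawing back to the original vertices. *)
set (idx := fun u => epsilon (inhabits 0%nat) (fun i => (i < n)%nat /\ v i = u)).
assert (idx_spec : forall u, (u < n)%nat -> (idx u < n)%nat /\ v (idx u) = u).
{ intros u Hu. apply (epsilon_spec (inhabits 0%nat) (fun i => (i < n)%nat /\ v i = u)).
  destruct (In_nth s u 0%nat) as (i & Hi & Ei).
  - apply (Permutation_in _ (Permutation_sym Hperm)). apply in_seq; lia.
  - exists i; split; [lia|exact Ei]. }
assert (hangs_on_exists : forall u, (3 <= u < n)%nat ->
  exists i j l, (i < j < l)%nat /\ A l i /\ A l j /\ hangs_on n A u i j l).
{ intros u Hu. destruct (Hatt u Hu) as (i & j & l & Hij & Hl & Aij & Ajl & Ail & Hm).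
  exists i, j, l; split; [easy|split; [now apply Esym|split; [now apply Esym|split; [easy|]]]].
  intros m; split.
  - intros [Hmu HA]; now apply Hm.
  - intros K. assert (m < u)%nat by lia. split; [easy|now apply Hm]. }
assert (hangs_on_unique : forall u u' a b c, hangs_on n A u a b c -> hangs_on n A u' a b c -> u = u').
{ assert (K : forall u u' a b c, hangs_on n A u a b c -> hangs_on n A u' a b c -> ~ (u < u')%nat).
  { intros u u' a b c [Hu H] [Hu' H'] Hlt. apply (Huniq u u'); try lia.
    intros m. exact (iff_trans (H m) (iff_sym (H' m))). }
  intros u u' a b c H H'. assert (K1 := K _ _ _ _ _ H H'). assert (K2 := K _ _ _ _ _ H' H). lia. }
destruct (tree_of_exists n A 0 1 2) as [t Ht].
assert (Hcover := tree_of_cover n A hangs_on_exists hangs_on_unique t Ht).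
assert (Hnd : NoDup (nodes t)) by (apply (tree_of_NoDup n A 0 1 2 t Ht); lia).
assert (Hsize := tree_of_size n A t Ht).
remember (2 ^ (12 + 2 * k))%nat as M eqn:EM.
assert (HM : (1 <= M)%nat) by (subst M; apply pow2_pos).
assert (Hfit : fits (sparse k) 0 (INR M) 0 (INR M) t) by (subst M; apply fits_grid; lia).
(* The default positions put the initial triangle at three corners of the square; they survive
   because these vertices are not nodes of [t]. *)
destruct (fits_positions _ _ _ _ _ _ Hfit Hnd
  (fun u => match u with 0 => (0, 0) | 1 => (M, 0) | _ => (0, M) end)%nat) as (pos & Epos & Hpos).
assert (Hsmall : forall u, (u < 3)%nat -> ~ In u (nodes t)).
{ intros u Hu K%(tree_of_nodes_gt _ _ _ _ _ _ Ht). lia. }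
assert (P0 : pos 0%nat = (0, 0)%nat) by (rewrite Epos; [easy|apply Hsmall; lia]).
assert (P1 : pos 1%nat = (M, 0)%nat) by (rewrite Epos; [easy|apply Hsmall; lia]).
assert (P2 : pos 2%nat = (0, M)%nat) by (rewrite Epos; [easy|apply Hsmall; lia]).
set (P := fun u => grid_point M (pos u)).
assert (Hnest : nested P 0 1 2 t).
{ apply (fits_at_nested (sparse k) pos M t HM 0 (INR M) 0 (INR M)); try easy;
  rewrite ?P0, ?P1, ?P2; simpl; try lra; lia. }
assert (Hdet : 0 < det (P 0%nat) (P 1%nat) (P 2%nat)).
{ unfold P; rewrite P0, P1, P2. apply det_grid_pos; cbn [fst snd]; lia. }
assert (Hall : forall u, (u < n)%nat -> In u ([0; 1; 2]%nat ++ nodes t)).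
{ intros u Hu. apply in_app_iff. destruct (Nat.le_gt_cases 3 u) as [H|H].
  - right; apply Hcover; lia.
  - left; simpl; lia. }
set (es := edges 0 1 2 t ++ [(0, 1); (1, 2); (2, 0)]%nat).
assert (Hedge : forall i j, (j < i)%nat -> (i < n)%nat -> A i j -> In (i, j) es \/ In (j, i) es).
{ intros i j Hji Hi HA. unfold es; rewrite !in_app_iff.
  destruct (Nat.le_gt_cases 3 i) as [H|H].
  - left; left. apply (tree_of_edges n A 0 1 2 t Ht); [apply Hcover; lia|easy|easy].
  - assert (K : (i = 1 /\ j = 0 \/ i = 2 /\ j = 0 \/ i = 2 /\ j = 1)%nat) by lia.
    destruct K as [[-> ->]|[[-> ->]|[-> ->]]]; simpl; tauto. }
assert (Hproper : forall i j i' j', (In (i, j) es \/ In (j, i) es) ->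
  (In (i', j') es \/ In (j', i') es) -> ~ same_edge (i, j) (i', j') -> proper P (i, j) (i', j')).
{ intros i j i' j' H H' Hne. unfold same_edge in Hne; simpl in Hne.
  destruct H as [H|H]; destruct H' as [H'|H'].
  - apply (edges_proper P t 0 1 2); try easy.
  - apply proper_sym, proper_swap, proper_sym.
    apply (edges_proper P t 0 1 2); try easy. unfold same_edge; simpl; tauto.
  - apply proper_swap.
    apply (edges_proper P t 0 1 2); try easy. unfold same_edge; simpl; tauto.
  - apply proper_sym, proper_swap, proper_sym, proper_swap.
    apply (edges_proper P t 0 1 2); try easy. unfold same_edge; simpl; tauto. }
assert (HE : forall a b, E a b -> In (idx a, idx b) es \/ In (idx b, idx a) es).
{ intros a b Hab. destruct (Ebound a b Hab) as [Ha Hb].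
  destruct (idx_spec a Ha) as [Ia Va]. destruct (idx_spec b Hb) as [Ib Vb].
  destruct (Nat.lt_trichotomy (idx a) (idx b)) as [H|[H|H]].
  - apply or_comm, Hedge; [easy|easy|]. unfold A; rewrite Va, Vb; now apply Esym.
  - exfalso. rewrite <- Va, <- Vb, H in Hab. now apply Eirr in Hab.
  - apply Hedge; [easy|easy|]. unfold A; now rewrite Va, Vb. }
exists (fun u => P (idx u)); split; [split|].
- intros u w Hu Hw Ep.
  destruct (idx_spec u Hu) as [Iu Vu]. destruct (idx_spec w Hw) as [Iw Vw].
  rewrite <- Vu, <- Vw. f_equal.
  apply (nested_inj P t 0 1 2); try easy; now apply Hall.
- intros a b c d Hab Hcd Hne x Hx Hx'.
  destruct (Ebound a b Hab) as [Ha Hb]. destruct (Ebound c d Hcd) as [Hc Hd].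
  assert (inj : forall u w, (u < n)%nat -> (w < n)%nat -> idx u = idx w -> u = w).
  { intros u w Hu Hw Eq. rewrite <- (proj2 (idx_spec u Hu)), <- (proj2 (idx_spec w Hw)).
    now rewrite Eq. }
  destruct (Hproper _ _ _ _ (HE a b Hab) (HE c d Hcd)) with (x := x) as (w & Hw & Hw' & Ew); try easy.
  { unfold same_edge; simpl; intros [[K1 K2]|[K1 K2]]; apply Hne;
      apply inj in K1, K2; tauto. }
  simpl in Hw, Hw'. subst x.
  destruct Hw as [->| ->]; [exists a|exists b]; split; auto; split; auto;
    destruct Hw' as [K|K]; apply inj in K; auto.
- intros u Hu. destruct (idx_spec u Hu) as [Iu _].
  apply (in_map (grid_point M)). rewrite (surjective_pairing (pos (idx u))).
  (* The columns [0] and [M] are multiples of [2 ^ k], so the outer corners are dyadic. *)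
  assert (EM' : M = (2 ^ k * 2 ^ (12 + k))%nat).
  { rewrite EM, <- Nat.pow_add_r. f_equal; lia. }
  assert (E0 : 0%nat = (2 ^ k * 0)%nat) by lia.
  specialize (Hall _ Iu). apply in_app_iff in Hall. destruct Hall as [H|H].
  + simpl in H. destruct H as [<-|[<-|[<-|[]]]]; rewrite ?P0, ?P1, ?P2; cbn [fst snd];
      apply in_sparse_list; rewrite <- ?EM; try lia; left.
    * rewrite E0 at 1; apply dyadic_multiple.
    * rewrite EM'; apply dyadic_multiple.
    * rewrite E0 at 1; apply dyadic_multiple.
  + destruct (fits_at_mem _ _ _ _ _ _ _ _ Hpos H) as (HS & Hx & Hy).
    apply INR_lt in Hx, Hy. apply in_sparse_list; rewrite <- ?EM; [easy|lia|lia].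
Qed.

Theorem theorem1 :
  exists C : R, 0 < C /\
    forall n : nat, exists S : list point,
      NoDup S /\
      ((2 <= n)%nat ->
         INR (length S) <= C * Rpower (INR n) (3 / 2) * ln (INR n)) /\
      (forall E : nat -> nat -> Prop, planar_3_tree n E ->
         exists p : nat -> point,
           straight_line_embedding n E p /\
           (forall v, (v < n)%nat -> In (p v) S)).
Proof.
exists (1824 * 2 ^ 24).
assert (P24 : 0 < 2 ^ 24) by (apply pow_lt; lra).
split; [lra|]. intros n.
destruct (Nat.le_gt_cases 3 n) as [Hn|Hn].
- destruct (pow4_above n) as (k & Hk1 & Hk2); [lia|].
  exists (map (grid_point (2 ^ (12 + 2 * k))) (sparse_list k)); split; [|split].
  + apply FinFun.Injective_map_NoDup; [|apply NoDup_nodup].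
    intros z z'; apply grid_point_inj, pow2_pos.
  + intros _. rewrite length_map. eapply Rle_trans.
    * apply le_INR, length_sparse_list.
    * now apply size_bound.
  + intros E HE. now apply embedding_exists.
(* With fewer than three vertices there is no planar 3-tree. *)
- exists []; split; [constructor|split].
  + intros Hn2. simpl. apply Rmult_le_pos.
    * apply Rmult_le_pos; [lra|]. left; apply exp_pos.
    * rewrite <- ln_1. apply ln_le; [lra|]. apply (le_INR 1). lia.
  + intros E (_ & H3 & _). lia.
Qed.
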